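(* Let $s,t,n,k$ be positive integers with $n/k\ge 2^{18}s(t+1)\log_2(n/k)$ and $n\ge 2^{15}sk\log_2 k$. Suppose that $\mathcal{F}\subset\binom{[n]}{k}$ contains no sunflower with $s$ petals whose core has size at most $t-1$. Then $$|\mathcal{F}|\le \phi(s,t)\binom{n-t}{k-t}+(2^{14}s\log_2 t)^t\cdot\frac{2^{19}s(t+1)\log_2(n/k)}{n/k}\cdot\binom{n-t}{k-t}.$$
   Context: $\binom{[n]}{k}$ is the family of all $k$-element subsets of $[n]=\{1,\dots,n\}$. A family of $s$ distinct sets $\{F_1,\dots,F_s\}$ is a sunflower with $s$ petals if $F_i\cap F_j=\bigcap_{u=1}^s F_u$ for all distinct $i,j$; the set $\bigcap_u F_u$ is its core. $\phi(s,t)$ is the maximum size of a $t$-uniform family containing no sunflower with $s$ petals (arbitrary core).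
   Formalization: The formal statement requires s ≥ 2 and t ≤ k: for s = 1 the claim fails (a single set is a 1-petal sunflower with core of size k, so the condition on F is void and φ(1,t)=0), and for t > k the binomial is 0 while a one-member family is allowed. *)

(* Defs.v *)
From mathcomp Require Import all_boot all_order all_algebra.
From mathcomp Require Import boolp reals exp.
From mathcomp Require classical_sets.

Set Implicit Arguments.
Unset Strict Implicit.
Unset Printing Implicit Defensive.

Import Order.TTheory GRing.Theory Num.Theory.

Local Open Scope nat_scope.

Definition uniform (T : finType) (k : nat) (F : {set {set T}}) : Prop :=
  forall A, A \in F -> #|A| = k.

Definition core (T : finType) (S : {set {set T}}) : {set T} :=
  \bigcap_(A in S) A.

Definition sunflower (T : finType) (s : nat) (S : {set {set T}}) : Prop :=
  #|S| = s /\
  forall A B, A \in S -> B \in S -> A != B -> A :&: B = core S.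

Definition sunflower_free (T : finType) (s : nat) (F : {set {set T}}) : Prop :=
  forall S : {set {set T}}, S \subset F -> ~ sunflower s S.

(* The ground set is an arbitrary finite type, unrelated to [n]. *)
Definition free_family_size (s t m : nat) : Prop :=
  exists (T : finType) (F : {set {set T}}),
    [/\ uniform t F, sunflower_free s F & #|F| = m].

Definition max_free_family_size (s t m : nat) : Prop :=
  free_family_size s t m /\ forall m', free_family_size s t m' -> m' <= m.

(* The default value 0 of xget is only reached for s = 0, see phiP below. *)
Definition phi (s t : nat) : nat := classical_sets.xget 0 (max_free_family_size s t).

Definition log2 (R : realType) (x : R) : R := (ln x / ln 2)%R.

Section ErdosRado.
Variable T : finType.
Implicit Types (F S : {set {set T}}) (A B : {set T}).

Lemma trivIset_sunflower s F : 0 < s -> s <= #|F| -> trivIset F ->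
  ~ sunflower_free s F.
Proof.
move=> s0 sF /trivIsetP tF free.
have [S SF cS] : exists2 S : {set {set T}}, S \subset F & #|S| = s.
  have : 0 < #|[set S : {set {set T}} | S \subset F & #|S| == s]|.
    by rewrite cards_draws bin_gt0.
  by case/card_gt0P => S; rewrite inE => /andP[SF /eqP cS]; exists S.
apply: (free _ SF); split=> // A B AS BS AB.
have AB0 : A :&: B = set0.
  by apply/eqP; rewrite setI_eq0; apply: tF => //; apply: (subsetP SF).
rewrite AB0; apply/esym/eqP; rewrite -subset0 -AB0.
by rewrite subsetI /core !bigcap_inf.
Qed.

Definition link (x : T) F : {set {set T}} :=
  [set A :\ x | A in [set A in F | x \in A]].

Lemma card_link x F : #|link x F| = #|[set A in F | x \in A]|.
Proof.
apply: card_in_imset => A B; rewrite !inE => /andP[_ xA] /andP[_ xB] AB.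
by rewrite -(setD1K xA) AB setD1K.
Qed.

Lemma link_uniform t x F : uniform t.+1 F -> uniform t (link x F).
Proof.
move=> uF B /imsetP[A]; rewrite inE => /andP[AF xA] ->.
by apply: succn_inj; rewrite -(uF A AF) (cardsD1 x A) xA.
Qed.

Lemma link_free s x F : sunflower_free s F -> sunflower_free s (link x F).
Proof.
move=> free S SL [cS sunS].
have SP A : A \in S -> x \notin A /\ x |: A \in F.
  move=> /(subsetP SL) /imsetP[B]; rewrite inE => /andP[BF xB] ->.
  by rewrite !inE eqxx setD1K.
have injS : {in S &, injective (fun A => x |: A)}.
  by move=> A B /SP[xA _] /SP[xB _] AB; rewrite -(setU1K xA) AB setU1K.
apply: (free [set x |: A | A in S]).
  by apply/subsetP => _ /imsetP[A AS ->]; case: (SP A AS).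
split; first by rewrite card_in_imset.
move=> _ _ /imsetP[A AS ->] /imsetP[B BS ->] AB.
have {}AB : A != B by apply: contraNneq AB => ->.
rewrite -setUIr (sunS A B) //.
apply/setP => y; rewrite !inE; apply/idP/bigcapP => [yS _ /imsetP[C CS ->]|yS].
  rewrite inE in_set1; case/orP: yS => [->//|/bigcapP yS].
  by rewrite (yS C CS) orbT.
have [//|yx] := eqVneq y x; apply/bigcapP => C CS.
have := yS (x |: C) (imset_f _ CS).
by rewrite !inE (negbTE yx).
Qed.

Lemma erdos_rado s t F : 0 < s -> uniform t F -> sunflower_free s F ->
  #|F| <= t`! * s ^ t.
Proof.
move=> s0; elim: t F => [|t IH] F uF free.
  have /subset_leq_card : F \subset [set set0].
    by apply/subsetP => A /uF /cards0_eq ->; rewrite inE.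
  by rewrite cards1.
pose P (M : {set {set T}}) := (M \subset F) && trivIset M.
have P0 : P set0 by rewrite /P sub0set; apply/trivIsetP => A B; rewrite inE.
have [M /maxsetP[/andP[MF tM] maxM] _] := maxset_exists P0.
have cM : #|M| <= s.
  rewrite leqNgt; apply/negP => sM.
  apply: (trivIset_sunflower s0 (ltnW sM) tM) => S SM.
  exact: free (subset_trans SM MF).
have cU : #|cover M| <= t.+1 * s.
  apply: leq_trans (leq_card_cover M) _.
  rewrite (eq_bigr (fun=> t.+1)) ?sum_nat_const; last first.
    by move=> A /(subsetP MF) /uF.
  by rewrite mulnC leq_mul2l cM orbT.
have FU : F \subset \bigcup_(x in cover M) [set A in F | x \in A].
  apply/subsetP => A AF.
  have [|] := boolP [exists x in cover M, x \in A].
    move=> /exists_inP[x xM xA]; apply/bigcupP; exists x => //.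
    by rewrite inE AF.
  rewrite negb_exists_in => /forall_inP dA.
  have disjA B : B \in M -> [disjoint A & B].
    move=> BM; rewrite disjoint_sym; apply/pred0P => x /=; apply/negP.
    move=> /andP[xB xA]; have /negP := dA x (subsetP (bigcup_sup B BM) x xB).
    by apply.
  have AM : A \in M.
    suff <- : A |: M = M by rewrite !inE eqxx.
    apply: maxM; last exact: subsetUr.
    rewrite /P subUset sub1set AF MF /=; apply/trivIsetP => B C.
    rewrite !inE => /predU1P[->|BM] /predU1P[->|CM]; rewrite ?eqxx //.
    - by move=> _; exact: disjA.
    - by move=> _; rewrite disjoint_sym; exact: disjA.
    - by move: BM CM; apply: (trivIsetP tM).
  have := uF A AF; have := disjA A AM.
  by rewrite -setI_eq0 setIid => /eqP ->; rewrite cards0.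
apply: leq_trans (subset_leq_card FU) _.
apply: leq_trans (_ : \sum_(x in cover M) #|[set A in F | x \in A]| <= _).
  elim/big_rec2: _ => [|x m U _ Um]; first by rewrite cards0.
  by rewrite (leq_trans (leq_card_setU _ _)) // leq_add2l.
apply: leq_trans (_ : \sum_(x in cover M) t`! * s ^ t <= _).
  apply: leq_sum => x _; rewrite -card_link; apply: IH.
    exact: link_uniform.
  exact: link_free.
rewrite sum_nat_const factS expnS mulnACA leq_mul //.
Qed.

End ErdosRado.

Lemma phiP s t : 0 < s -> max_free_family_size s t (phi s t).
Proof.
move=> s0; rewrite /phi.
suff [m Hm] : exists m, max_free_family_size s t m.
  by apply: classical_sets.xgetPex; exists m.
have ex0 : exists m, `[< free_family_size s t m >].
  exists 0; apply/asboolP; exists unit, set0; split.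
  - by move=> A; rewrite inE.
  - move=> S; rewrite subset0 => /eqP -> [].
    by rewrite cards0 => s_0; rewrite -s_0 in s0.
  - by rewrite cards0.
have ub m : `[< free_family_size s t m >] -> m <= t`! * s ^ t.
  by move=> /asboolP[T [F [uF fF <-]]]; exact: erdos_rado.
case: (ex_maxnP ex0 ub) => m /asboolP Hm maxm.
by exists m; split=> // m' Hm'; apply: maxm; apply/asboolP.
Qed.

(* Main.v *)
(**
  For [t >= 2] we use spread approximation. Call [B] a spread core of [F] if some
  nonempty subfamily of [F] whose members contain [B] is [n / 2k]-spread once [B] is
  removed. By the spread lemma, a sunflower of spread cores lifts to a sunflower of
  [F] with the same core, so the spread cores of size at most
  [q = (t + 1) log2 (n / k)] contain no sunflower whose core has fewer than [t]
  elements; the members of [F] containing no such [B] number at most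
  [k / n * C(n - t, k - t)].
  Enlarge this family of cores to a maximal one with the same property and keep its
  minimal members. Those of size [t] are at most [phi s t] in number. For those of
  size [i > t], maximality bounds the degree of a set [X] with [t <= |X|] by
  [(s q) ^ (i - |X|)], and a second use of the spread lemma bounds their number by
  [(O(s log2 i)) ^ t * (O(s q)) ^ (i - t)], so that their contributions decrease
  geometrically in [i].
  The spread lemma is proved by repeatedly exposing random sets [W] and replacing each
  member by its smallest fragment [g j \ W] available inside [W :|: g i]; with
  constant probability an exposure halves the sizes of almost all members.
  For [t = 1] the error term vanishes, and Katona's circle argument gives the sharp
  bound [(s - 1) * C(n - 1, k - 1)].
*)
Require Import Defs.
From mathcomp Require Import all_boot all_order all_algebra all_fingroup.
From mathcomp Require Import boolp reals sequences exp.
From mathcomp Require Import zify ring lra.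

Set Implicit Arguments.
Unset Strict Implicit.
Unset Printing Implicit Defensive.

Import Order.TTheory GRing.Theory Num.Theory.
Local Open Scope ring_scope.

(** * The spread lemma *)

Section Biased.
Variables (R : realType) (T : finType).
Implicit Types (p q : R) (W U Z : {set T}).

(** The probability of [W] when every point is kept independently with probability [p]; expectations
    below are finite sums with these weights. *)
Definition biased p W : R := \prod_x (if x \in W then p else 1 - p).

Lemma biased_ge0 p W : 0 <= p <= 1 -> 0 <= biased p W.
Proof. by move=> p01; apply: prodr_ge0 => x _; case: ifP => _; lra. Qed.

(** Colour the points independently with law [w]. The total weight of the colourings with a
    prescribed set of [phi]-coloured points factors over the points. *)
Lemma biased_pushforward (C : finType) (w : C -> R) (phi : pred C) p
    (H : {set T} -> R) :
  \sum_(c | phi c) w c = p -> \sum_(c | ~~ phi c) w c = 1 - p ->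
  \sum_(f : {ffun T -> C}) (\prod_x w (f x)) * H [set x | phi (f x)]
    = \sum_W biased p W * H W.
Proof.
move=> wp wNp.
rewrite (partition_big (fun f : {ffun T -> C} => [set x | phi (f x)]) predT) //=.
apply: eq_bigr => W _.
rewrite (eq_bigr (fun f : {ffun T -> C} => (\prod_x w (f x)) * H W)); last by move=> f /eqP ->.
rewrite -big_distrl /=; congr (_ * _).
transitivity (\prod_x \sum_(c | phi c == (x \in W)) w c); last first.
  apply: eq_bigr => x _; case: (x \in W).
    by rewrite -wp; apply: eq_bigl => c; rewrite eqb_id.
  by rewrite -wNp; apply: eq_bigl => c; rewrite eqbF_neg.
rewrite bigA_distr_big_dep; apply: eq_bigl => f.
apply/eqP/familyP => [<- x|fW].
  by rewrite unfold_in /= inE.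
by apply/setP => x; move: (fW x); rewrite unfold_in inE => /eqP.
Qed.

Lemma sum_biased p : \sum_W biased p W = 1.
Proof.
rewrite -(bigA_distr _ _ (fun=> p) (fun _ : T => 1 - p)) big1 // => x _ /=.
by rewrite addrC subrK.
Qed.

(** Colour each point by a pair of independent booleans; the union collects the points where at
    least one of them is true. *)
Lemma biased_union p q (H : {set T} -> R) :
  \sum_W biased p W * (\sum_U biased q U * H (W :|: U))
    = \sum_Z biased (p + (1 - p) * q) Z * H Z.
Proof.
pose w (c : bool * bool) := (if c.1 then p else 1 - p) * (if c.2 then q else 1 - q).
have sumw (G : bool * bool -> R) : \sum_c G c
    = G (true, true) + G (true, false) + (G (false, true) + G (false, false)).
  rewrite (eq_bigr (fun c => G (c.1, c.2))); last by case.
  by rewrite -(pair_bigA _ (fun a b => G (a, b))) !big_bool.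
rewrite -[RHS](@biased_pushforward _ w (fun c => c.1 || c.2)); last 2 first.
- by rewrite big_mkcond sumw /w /=; ring.
- by rewrite big_mkcond sumw /w /=; ring.
under eq_bigr do rewrite big_distrr /=.
rewrite pair_big /=.
pose h (f : {ffun T -> bool * bool}) := ([set x | (f x).1], [set x | (f x).2]).
rewrite (reindex h) /=; last first.
  exists (fun WU : {set T} * {set T} => [ffun x => (x \in WU.1, x \in WU.2)]) => [f _|[W U] _].
    by apply/ffunP => x; rewrite ffunE !inE; case: (f x).
  by congr (_, _); apply/setP => x; rewrite inE ffunE.
apply: eq_bigr => f _; rewrite mulrA -big_split /=; congr (_ * H _).
  by apply: eq_bigr => x _; rewrite !inE.
by apply/setP => x; rewrite !inE.
Qed.

End Biased.

(** * Minimal fragments outside an exposed set *)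

Section Fragment.
Variables (R : realType) (T I : finType) (P : {set I}) (g : I -> {set T}).
Implicit Types (W U Z Y : {set T}) (i j : I).

(** For [i] in [P] the index [i] itself competes. The fragment stays inside [g i], so passing to
    fragments never increases the number of members containing a given set. *)
Definition fragment i W : {set T} :=
  let j := [arg min_(j < i | (j \in P) && (g j \subset W :|: g i)) #|g j :\: W|] in
  g j :\: W.

Lemma fragmentP i W : i \in P ->
  exists j, [/\ j \in P, g j \subset W :|: g i, fragment i W = g j :\: W &
    forall j', j' \in P -> g j' \subset W :|: g i ->
      (#|fragment i W| <= #|g j' :\: W|)%N].
Proof.
move=> iP; rewrite /fragment; case: arg_minnP => [|j /andP[jP jW] jmin].
  by rewrite iP subsetUr.
by exists j; split=> // j' j'P j'W; apply: jmin; rewrite j'P.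
Qed.

Lemma fragment_sub i W : i \in P -> fragment i W \subset g i.
Proof. by case/(fragmentP W) => j [_ jW -> _]; rewrite subDset. Qed.

Lemma fragment_disjoint i W : fragment i W :&: W = set0.
Proof. by rewrite /fragment setDE -setIA [~: W :&: W]setIC setICr setI0. Qed.

Lemma fragment_cover i W : i \in P ->
  exists2 j, j \in P & g j \subset W :|: fragment i W.
Proof. by case/(fragmentP W) => j [jP _ -> _]; exists j => //; rewrite -subDset. Qed.

(* A member inside [W :|: fragment i W] competes with the minimizer defining the
   fragment, so it must contain the whole fragment. *)
Lemma fragment_min i j W : i \in P -> j \in P ->
  g j \subset W :|: fragment i W -> fragment i W \subset g j.
Proof.
move=> iP jP jZ; have fi := fragment_sub W iP.
have [_ [_ _ _ fmin]] := fragmentP W iP.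
have jf : g j :\: W \subset fragment i W by rewrite subDset.
have jW : g j \subset W :|: g i by apply: subset_trans jZ (setUS _ fi).
have /eqP <- : g j :\: W == fragment i W by rewrite eqEcard jf fmin.
exact: subsetDl.
Qed.

(** For [K = #|P|] this is [r]-spreadness. Keeping [K] fixed while members are discarded lets the
    bound pass to subfamilies. *)
Definition spread_bound (K r : R) :=
  forall Y, #|[set i in P | Y \subset g i]|%:R * r ^+ #|Y| <= K.

Lemma biased_setD (p : R) Z Y : 0 < p <= 1 -> Y \subset Z ->
  biased p (Z :\: Y) <= biased p Z * (p^-1) ^+ #|Y|.
Proof.
move=> /andP[p0 p1] YZ.
rewrite -prodr_const [X in _ <= _ * X]big_mkcond -big_split /=.
apply: ler_prod => x _; rewrite !inE.
case: (boolP (x \in Y)) => [/(subsetP YZ) ->|_] /=.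
  by rewrite divff ?gt_eqF //; lra.
by rewrite mulr1; case: ifP => _; rewrite lexx andbT; lra.
Qed.

(* Recolouring the fragment, [W |-> W :|: fragment i W], loses a factor [1 / p]
   per element, and spreadness gains a factor [1 / r] per element. *)
Lemma expected_large_fragments (K r p : R) (u : nat) :
  0 < p <= 1 -> 1 <= p * r -> 0 <= K -> spread_bound K r ->
  {in P, forall i, (#|g i| <= u.*2)%N} ->
  \sum_W biased p W * #|[set i in P | (u <= #|fragment i W|)%N]|%:R
    <= K * (4 / (p * r)) ^+ u.
Proof.
move=> p01 pr1 K0 spr gu; have /andP[p0 p1] := p01.
have r0 : 0 < r by rewrite -(pmulr_rgt0 _ p0); lra.
(* [J Z] depends on [Z] alone, yet contains the fragment whenever [Z = W :|: fragment P g i W];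
   hence a given [Z] leaves at most [4 ^ u] candidates for the fragment. *)
pose J Z := odflt set0 (omap g [pick j in P | g j \subset Z]).
have cJ Z : (#|J Z| <= u.*2)%N.
  by rewrite /J; case: pickP => [j /andP[/gu] //|_ /=]; rewrite cards0.
have Jfrag i W : i \in P -> fragment i W \subset J (W :|: fragment i W).
  move=> iP; rewrite /J; case: pickP => [j /andP[jP jZ] /=|no]; first exact: fragment_min.
  by have [j jP jZ] := fragment_cover W iP; move: (no j); rewrite /= jP jZ.
(* Here [Z] stands for [W :|: fragment P g i W] and [Y] for the fragment. Since [W = Z :\: Y],
   distinct [W] give distinct pairs. *)
pose M : R := \sum_Z \sum_(Y : {set T} | (Y \subset J Z) && (u <= #|Y|)%N)
  \sum_(i in P | Y \subset g i) biased p Z * (p^-1) ^+ #|Y|.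
apply: (@le_trans _ _ M).
  rewrite /M; under eq_bigr => W _ do rewrite cardsE -sum1_card natr_sum mulr_sumr.
  rewrite (exchange_big_dep (mem P)) /=; last by move=> W i _ /andP[].
  rewrite [leRHS]pair_big_dep /= [leRHS](exchange_big_dep (mem P)) /=; last by move=> ? ? ? /andP[].
  apply: ler_sum => i iP; rewrite iP /=.
  rewrite (partition_big (fun W => (W :|: fragment i W, fragment i W))
    (fun ZY : {set T} * {set T} => (ZY.2 \subset J ZY.1) && (u <= #|ZY.2|)%N && (ZY.2 \subset g i)));
    last by move=> W /=; rewrite unfold_in iP /= => uf; rewrite Jfrag // uf fragment_sub.
  apply: ler_sum => -[Z Y] /= _.
  have B0 : 0 <= biased p Z * (p^-1) ^+ #|Y|.
    by rewrite mulr_ge0 ?biased_ge0 ?exprn_ge0 ?invr_ge0 //; lra.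
  apply: (@le_trans _ _ (\sum_(W : {set T} | W == Z :\: Y) biased p Z * (p^-1) ^+ #|Y|)); last first.
    by rewrite big_pred1_eq.
  rewrite big_mkcond [leRHS]big_mkcond; apply: ler_sum => W _.
  case: andP => [[_ /eqP[eZ eY]]|_]; last by case: ifP.
  have eW : W = Z :\: Y.
    by rewrite -eZ -eY setDUl setDv setU0 -[LHS](setID _ (fragment i W)) setIC fragment_disjoint set0U.
  by rewrite mulr1 eW eqxx /= biased_setD // -eZ -eY subsetUr.
apply: (@le_trans _ _ (\sum_Z biased p Z * (K * (4 / (p * r)) ^+ u))); last first.
  by rewrite -big_distrl /= sum_biased mul1r.
apply: ler_sum => Z _.
under eq_bigr do rewrite -big_distrr /=.
rewrite -big_distrr /=; apply: ler_wpM2l; first by rewrite biased_ge0 //; lra.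
apply: (@le_trans _ _ (\sum_(Y : {set T} | Y \subset J Z) K * ((p * r)^-1) ^+ u)).
  rewrite big_mkcondr; apply: ler_sum => Y _.
  case: ifP => uY; last by rewrite mulr_ge0 ?exprn_ge0 ?invr_ge0 //; lra.
  rewrite sumr_const -[_ *+ _]mulr_natl.
  have -> : #|[pred i in P | Y \subset g i]| = #|[set i in P | Y \subset g i]|.
    by rewrite cardsE.
  have := spr Y; set c := #|_|%:R => cK.
  apply: (@le_trans _ _ (K * ((p * r)^-1) ^+ #|Y|)).
    rewrite invfM exprMn [leRHS]mulrCA [leLHS]mulrC; apply: ler_wpM2l.
      by rewrite exprn_ge0 // invr_ge0 ltW.
    by rewrite exprVn ler_pdivlMr // exprn_gt0.
  apply: ler_wpM2l => //; apply: ler_wiXn2l => //; first by rewrite invr_ge0; lra.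
  by rewrite invf_le1 //; lra.
rewrite -big_distrr /=; apply: ler_wpM2l => //.
rewrite sumr_const -[_ *+ _]mulr_natl exprMn; apply: ler_wpM2r.
  by rewrite exprn_ge0 // invr_ge0; lra.
have -> : #|[pred Y : {set T} | Y \subset J Z]| = #|powerset (J Z)|.
  by apply: eq_card => Y; rewrite !inE.
rewrite card_powerset -natrX ler_nat -[4%N]/(2 ^ 2)%N -expnM leq_exp2l // mul2n.
exact: cJ.
Qed.

End Fragment.

(** * Pairwise disjoint members of spread families *)

Section SpreadLemma.
Variables (R : realType) (T I : finType).
Implicit Types (P : {set I}) (g : I -> {set T}) (W U : {set T}).

Definition misses P g W : bool := [forall i in P, ~~ (g i \subset W)].

Lemma missesW P g W U : W \subset U -> misses P g U -> misses P g W.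
Proof.
move=> WU /forall_inP mU; apply/forall_inP => i /mU; apply: contra => iW.
exact: subset_trans iW WU.
Qed.

(** [1 - (1 - p) ^+ b] is the density of the union of [b] independent [p]-biased sets. *)
Lemma union_density_ge0_le1 (p : R) b : 0 < p <= 1 -> 0 <= 1 - (1 - p) ^+ b <= 1.
Proof.
move=> p01; have h : 0 <= (1 - p) ^+ b by rewrite exprn_ge0 //; lra.
by have : (1 - p) ^+ b <= 1; [rewrite exprn_ile1 //; lra | lra].
Qed.

Lemma union_density_le (p : R) b : 0 < p <= 1 -> 1 - (1 - p) ^+ b <= b%:R * p.
Proof.
move=> p01; elim: b => [|b IH]; first by rewrite expr0 mul0r subrr.
have h : 0 <= (1 - p) ^+ b <= 1.
  by have := union_density_ge0_le1 b p01; lra.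
by rewrite exprS -[b.+1]addn1 natrD; nra.
Qed.

(* A round is lost when more than [K / 2 ^ (l + 2)] members keep a fragment of size at
   least [2 ^ l]; this has probability at most [1 / 4], and otherwise the level drops.
   Hence the expectation of [4 ^ level] halves in each round. *)
Lemma prob_misses (r p K : R) b l P g :
  0 < p <= 1 -> 64 <= p * r -> 0 < K -> spread_bound P g K r ->
  {in P, forall i, (#|g i| < 2 ^ l)%N} ->
  K * (1 - (2^-1) ^+ l.+1) <= #|P|%:R ->
  \sum_W biased (1 - (1 - p) ^+ b) W * (misses P g W)%:R <= 4 ^+ l / 2 ^+ b.
Proof.
move=> p01 pr K0; elim: b l P g => [|b IH] l P g spr gl mP.
  rewrite !expr0 divr1 subrr; apply: (@le_trans _ _ 1); last by rewrite exprn_ege1 //; lra.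
  rewrite -[leRHS](sum_biased T (0 : R)); apply: ler_sum => W _.
  apply: ler_piMr; first by rewrite biased_ge0 // lexx ler01.
  by rewrite lern1 leq_b1.
(* At level 0 every member is empty and [P] is nonempty, so no set misses the family. *)
case: l => [|l] in gl mP *.
  rewrite big1 ?mulr_ge0 ?invr_ge0 ?exprn_ge0 // => W _.
  have : (0 < #|P|)%N by rewrite -(ltr_nat R); move: mP; rewrite expr1; lra.
  case/card_gt0P => i iP; have := gl _ iP; rewrite ltnS leqn0 cards_eq0 => /eqP gi0.
  suff /negbTE -> : ~~ misses P g W by rewrite mulr0.
  by apply/negP => /forall_inP/(_ i iP); rewrite gi0 sub0set.
have -> : 1 - (1 - p) ^+ b.+1 = p + (1 - p) * (1 - (1 - p) ^+ b) by rewrite exprS; ring.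
rewrite -(biased_union _ _ (fun Z => (misses P g Z)%:R)).
pose q := 1 - (1 - p) ^+ b; rewrite -/q.
have q01 : 0 <= q <= 1 by exact: union_density_ge0_le1.
pose u := (2 ^ l)%N; have u0 : (0 < u)%N by rewrite expn_gt0.
pose large W := [set i in P | (u <= #|fragment P g i W|)%N].
pose bad W := K * (2^-1) ^+ l.+2 < #|large W|%:R.
have c0 : 0 < (2^-1 : R) ^+ l.+2 by rewrite exprn_gt0 // invr_gt0.
have d0 : 0 < (4 : R) ^+ l / 2 ^+ b by rewrite mulr_gt0 ?invr_gt0 ?exprn_gt0.
(* After a bad round the old family is kept at its old level, which costs a factor 4; after a good
   round the small fragments form a family one level lower. *)
have inner W : \sum_U biased q U * (misses P g (W :|: U))%:R
    <= 4 ^+ l / 2 ^+ b * (1 + 4 * (bad W)%:R).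
  have [bW|gW] := boolP (bad W).
    apply: (@le_trans _ _ (4 ^+ l.+1 / 2 ^+ b)); last by rewrite exprS /= mulr1n; move: d0; lra.
    apply: le_trans (IH _ _ _ spr gl mP); apply: ler_sum => U _.
    apply: ler_wpM2l; first exact: biased_ge0.
    by rewrite ler_nat; case: (boolP (misses _ _ _)) => // /(missesW (subsetUr W U)) ->.
  rewrite /= mulr0n mulr0 addr0 mulr1.
  pose P' := P :\: large W.
  have P'P i : i \in P' -> i \in P by rewrite inE => /andP[].
  apply: le_trans (IH l P' (fragment P g ^~ W) _ _ _).
  - apply: ler_sum => U _; apply: ler_wpM2l; first exact: biased_ge0.
    rewrite ler_nat; case: (boolP (misses P g _)) => // /forall_inP mWU.
    suff -> : misses P' (fragment P g ^~ W) U by [].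
    apply/forall_inP => i /P'P iP; have [j jP jW] := fragment_cover g W iP.
    by apply: contra (mWU j jP) => iU; apply: subset_trans jW (setUS _ iU).
  - move=> Y; apply: le_trans (spr Y); apply: ler_wpM2r.
      by rewrite exprn_ge0 //; nra.
    rewrite ler_nat subset_leq_card //; apply/subsetP => i; rewrite !inE.
    move=> /andP[/andP[_ iP] Yi]; rewrite iP.
    exact: subset_trans Yi (fragment_sub g W iP).
  - by move=> i; rewrite !inE => /andP[+ iP]; rewrite iP /= -ltnNge.
  - have : #|P'|%:R = #|P|%:R - #|large W|%:R :> R.
      rewrite -(cardsID (large W) P) natrD; suff -> : P :&: large W = large W by ring.
      by apply/setIidPr/subsetP => i; rewrite inE => /andP[].
    move: gW; rewrite /bad -leNgt => gW ->; move: mP gW; rewrite ![_ ^+ l.+2]exprS.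
    by set z := _ ^+ l.+1; lra.
(* Markov's inequality at the threshold [K / 2 ^ (l + 2)]. As [64 <= p * r], the expectation is at
   most [K / 16 ^ u], and with [u = 2 ^ l] the claim becomes [16 * u <= 16 ^ u]. *)
have markov : \sum_W biased p W * (bad W)%:R <= 4^-1.
  have e := expected_large_fragments (u := u) p01 _ (ltW K0) spr _.
  have {e} e : \sum_W biased p W * #|large W|%:R <= K * (4 / (p * r)) ^+ u.
    by apply: e; [lra | move=> i iP; rewrite -muln2 -expnSr ltnW // gl].
  have h : (\sum_W biased p W * (bad W)%:R) * (K * (2^-1) ^+ l.+2) <= K * (16^-1) ^+ u.
    apply: (@le_trans _ _ (K * (4 / (p * r)) ^+ u)).
      apply: le_trans e; rewrite mulr_suml; apply: ler_sum => W _.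
      rewrite -mulrA; apply: ler_wpM2l; first by rewrite biased_ge0 //; lra.
      by rewrite /bad; case: ltP => [/ltW|_]; rewrite ?mul1r ?mul0r.
    apply: ler_wpM2l; first exact: ltW.
    apply: lerXn2r; rewrite ?nnegrE ?invr_ge0 //; first by rewrite divr_ge0 //; lra.
    by rewrite ler_pdivrMr; lra.
  move: h; rewrite mulrCA ler_pM2l // -ler_pdivlMr // => /le_trans; apply.
  rewrite !exprVn invrK ler_pdivrMl ?exprn_gt0 // ler_pdivlMr // -!natrX -natrM ler_nat.
  have -> : (2 ^ l.+2 * 4 = 16 * u)%N by rewrite !expnS /u; lia.
  have key v : (0 < v -> 16 * v <= 16 ^ v)%N.
    by case: v => // v _; rewrite expnS leq_mul2l /= ltn_expl.
  exact: key.
apply: (@le_trans _ _ (\sum_W biased p W * (4 ^+ l / 2 ^+ b * (1 + 4 * (bad W)%:R)))).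
  by apply: ler_sum => W _; apply: ler_wpM2l (inner W); rewrite biased_ge0 //; lra.
under eq_bigr do rewrite mulrCA mulrDr mulr1 [biased _ _ * (4 * _)]mulrCA.
rewrite -big_distrr /= big_split /= sum_biased -big_distrr /=.
rewrite [4 ^+ l.+1]exprS [2 ^+ b.+1]exprS invfM.
have -> : 4 * 4 ^+ l * (2^-1 * (2 ^+ b)^-1) = 4 ^+ l / 2 ^+ b * 2 :> R.
  by move: (2 ^+ b)^-1 => c; field.
by apply: ler_wpM2l; [exact: ltW | move: markov; lra].
Qed.

Lemma exists_le_average (F : finType) (w X : F -> R) (c : R) :
  (forall f, 0 <= w f) -> \sum_f w f = 1 -> \sum_f w f * X f <= c ->
  exists f, X f <= c.
Proof.
move=> w0 w1 wX; apply/existsP; apply: contraT; rewrite negb_exists => /forallP Xc.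
have pos f : 0 <= w f * (X f - c).
  by rewrite mulr_ge0 // subr_ge0 ltW // ltNge.
have sum0 : \sum_f w f * (X f - c) = 0.
  apply/le_anti; rewrite sumr_ge0 // andbT.
  under eq_bigr do rewrite mulrBr.
  by rewrite sumrB -mulr_suml w1 mul1r subr_le0.
have w00 f : w f = 0.
  have /eqP : w f * (X f - c) = 0 by apply: (psumr_eq0P (P := predT)) sum0 _ _.
  by rewrite mulf_eq0 => /orP[/eqP//|]; rewrite subr_eq0 => /eqP e; have := Xc f; rewrite e lexx.
by move: w1; rewrite big1 // => /esym/eqP; rewrite oner_eq0.
Qed.

(** Give each point one of [N] colours, each with the density [d] of [b] exposures, or no colour at
    all. The choice [p = 1 / (N * b)] ensures [N * d <= 1]. Each colour class is [d]-biased, so the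
    expected number of classes missing their family is bounded, and some colouring does no worse. *)
Lemma few_missing_classes (N b L : nat) (r : R) (P : 'I_N -> {set I})
    (g : 'I_N -> I -> {set T}) :
  (0 < N)%N -> (0 < b)%N -> 64 * N%:R * b%:R <= r ->
  (forall j, (0 < #|P j|)%N) ->
  (forall j, spread_bound (P j) (g j) #|P j|%:R r) ->
  (forall j, {in P j, forall i, (#|g j i| < 2 ^ L)%N}) ->
  exists f : T -> option 'I_N,
    #|[set j | misses (P j) (g j) [set x | f x == Some j]]|%:R
      <= N%:R * (4 ^+ L / 2 ^+ b) :> R.
Proof.
move=> N0 b0 rN P0 spr gL.
have N1 : 1 <= N%:R :> R by rewrite ler1n.
have b1 : 1 <= b%:R :> R by rewrite ler1n.
pose p : R := (N%:R * b%:R)^-1.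
have Nb1 : 1 <= N%:R * b%:R :> R by nra.
have p01 : 0 < p <= 1 by rewrite invr_gt0 invf_le1; lra.
have pr : 64 <= p * r by rewrite mulrC ler_pdivlMr; lra.
pose d := 1 - (1 - p) ^+ b.
have d01 : 0 <= d <= 1 := union_density_ge0_le1 b p01.
have Nd : N%:R * d <= 1.
  apply: (@le_trans _ _ (N%:R * (b%:R * p))); last by rewrite mulrA divff //; lra.
  by apply: ler_wpM2l (union_density_le b p01); lra.
pose w (c : option 'I_N) : R := if c is Some _ then d else 1 - N%:R * d.
have sumw (G : option 'I_N -> R) : \sum_c G c = G None + \sum_j G (Some j).
  rewrite (bigD1 None) //=; congr (_ + _).
  rewrite (reindex_omap Some id) /=; last by case.
  by apply: eq_bigl => j; rewrite eqxx.
have w1 : \sum_c w c = 1 by rewrite sumw /= sumr_const card_ord -mulr_natl; ring.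
have w0 c : 0 <= w c by case: c => [j|] /=; lra.
pose X (f : {ffun T -> option 'I_N}) : R :=
  #|[set j | misses (P j) (g j) [set x | f x == Some j]]|%:R.
have [|||f Xf] := @exists_le_average _ (fun f : {ffun T -> option 'I_N} => \prod_x w (f x))
  X (N%:R * (4 ^+ L / 2 ^+ b)); last by exists f.
- by move=> f; rewrite prodr_ge0.
- by rewrite -(bigA_distr_bigA (fun _ : T => w)) big1.
have XE f : X f = \sum_j (misses (P j) (g j) [set x | f x == Some j])%:R.
  rewrite /X -sum1_card big_mkcond natr_sum; apply: eq_bigr => j _.
  by rewrite inE; case: misses.
under eq_bigr => f _ do rewrite XE mulr_sumr.
rewrite exchange_big /= -[X in X%:R * _]card_ord mulr_natl -sumr_const.
apply: ler_sum => j _.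
have w0j : \sum_(c : option 'I_N | ~~ (c == Some j)) w c = 1 - d.
  by have := w1; rewrite (bigD1 (Some j)) //= => <-; rewrite addrAC subrr add0r.
have wj : \sum_(c : option 'I_N | c == Some j) w c = d by rewrite big_pred1_eq.
have K0 : 0 < #|P j|%:R :> R by rewrite ltr0n.
apply: le_trans (prob_misses b p01 pr K0 (spr j) (gL j) _); last first.
  apply: ler_piMr; first exact: ltW.
  by have : 0 <= (2^-1 : R) ^+ L.+1; [rewrite exprn_ge0 // invr_ge0 | lra].
rewrite -/d -(biased_pushforward _ wj w0j).
exact: lexx.
Qed.

(** The number of missing classes is an integer below 1, so each class contains a member of its own
    family, and distinct classes are disjoint. *)
Lemma rainbow_matching (N b L : nat) (r : R) (P : 'I_N -> {set I})
    (g : 'I_N -> I -> {set T}) :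
  (0 < b)%N -> 64 * N%:R * b%:R <= r -> (N * 4 ^ L < 2 ^ b)%N ->
  (forall j, (0 < #|P j|)%N) ->
  (forall j, spread_bound (P j) (g j) #|P j|%:R r) ->
  (forall j, {in P j, forall i, (#|g j i| < 2 ^ L)%N}) ->
  exists a : 'I_N -> I, (forall j, a j \in P j) /\
    (forall j j', j != j' -> [disjoint g j (a j) & g j' (a j')]).
Proof.
case: N P g => [|N] P g b0 rN Nb P0 spr gL.
  have a0 : 'I_0 -> I by case.
  by exists a0; split=> -[].
have [f few] := few_missing_classes (ltn0Sn N) b0 rN P0 spr gL.
have none : [set j | misses (P j) (g j) [set x | f x == Some j]] = set0.
  apply/eqP; rewrite -cards_eq0 -leqn0 -ltnS -(ltr_nat R); apply: le_lt_trans few _.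
  by rewrite mulrA ltr_pdivrMr ?exprn_gt0 // mul1r -!natrX -natrM ltr_nat.
have hit j : exists i, (i \in P j) && (g j i \subset [set x | f x == Some j]).
  have : j \notin [set j | misses (P j) (g j) [set x | f x == Some j]] by rewrite none inE.
  rewrite inE negb_forall_in => /exists_inP[i iP]; rewrite negbK => ij.
  by exists i; rewrite iP.
exists (fun j => xchoose (hit j)); split=> [j|j j' jj'].
  by have /andP[] := xchooseP (hit j).
have /andP[_ s1] := xchooseP (hit j); have /andP[_ s2] := xchooseP (hit j').
apply: disjointWl s1 _; apply: disjointWr s2 _.
rewrite -setI_eq0; apply/eqP/setP => x; rewrite !inE.
by apply/negP => /andP[/eqP -> /eqP[e]]; rewrite e eqxx in jj'.
Qed.

(* With [2 s] classes it suffices that half of them succeed on average, which avoids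
   a factor [log s] in the spreadness. *)
Lemma spread_matching (s L : nat) (r : R) (P : {set I}) (g : I -> {set T}) :
  (0 < s)%N -> 128 * s%:R * (2 * L%:R + 1) <= r ->
  (0 < #|P|)%N -> spread_bound P g #|P|%:R r ->
  {in P, forall i, (#|g i| < 2 ^ L)%N} ->
  exists a : 'I_s -> I, (forall j, a j \in P) /\
    (forall j j', j != j' -> [disjoint g (a j) & g (a j')]).
Proof.
move=> s0 rs P0 spr gL.
(* With [b = 2 * L + 1] exposures a class fails with probability at most [1 / 2], so some colouring
   leaves at least [s] of the [2 * s] classes successful. *)
have [|||//|//|//|f few] := @few_missing_classes (2 * s) (2 * L).+1 L r (fun=> P) (fun=> g).
- by rewrite muln_gt0.
- by [].
- by rewrite -addn1 natrD !natrM; move: rs; lra.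
pose bad := [set j | misses P g [set x | f x == Some j]].
have cbad : (#|bad| <= s)%N.
  rewrite -(ler_nat R); apply: le_trans few _.
  have -> : (2 : R) ^+ (2 * L).+1 = 2 * 4 ^+ L.
    by rewrite exprS exprM; congr (_ * _ ^+ L); ring.
  have : (4 : R) ^+ L != 0 by rewrite expf_neq0 // pnatr_eq0.
  by rewrite natrM; move: (_ ^+ L) => x x0; rewrite le_eqVlt; apply/orP; left; apply/eqP; field.
have cgood : (s <= #|~: bad|)%N.
  by have := cardsC bad; rewrite card_ord; lia.
pose j_ (j : 'I_s) := enum_val (widen_ord cgood j).
have hit j : exists i, (i \in P) && (g i \subset [set x | f x == Some (j_ j)]).
  have := enum_valP (widen_ord cgood j); rewrite -/(j_ j) !inE.
  rewrite negb_forall_in => /exists_inP[i iP]; rewrite negbK => ij.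
  by exists i; rewrite iP.
exists (fun j => xchoose (hit j)); split=> [j|j j' jj'].
  by have /andP[] := xchooseP (hit j).
have /andP[_ s1] := xchooseP (hit j); have /andP[_ s2] := xchooseP (hit j').
apply: disjointWl s1 _; apply: disjointWr s2 _.
rewrite -setI_eq0; apply/eqP/setP => x; rewrite !inE.
apply/negP => /andP[/eqP -> /eqP[/enum_val_inj/(congr1 val)/= e]].
by move/eqP: jj'; apply; apply: val_inj.
Qed.

End SpreadLemma.

(** * Families without sunflowers of small core *)

Section Sunflowers.
Variable T : finType.
Implicit Types (F S M : {set {set T}}) (A B C K X Y : {set T}).

Definition low_core_free (s t : nat) F : Prop :=
  forall S, S \subset F -> sunflower s S -> (t <= #|core S|)%N.

Lemma core_pairwise S K : (1 < #|S|)%N ->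
  (forall A B, A \in S -> B \in S -> A != B -> A :&: B = K) -> core S = K.
Proof.
move=> S1 SK; have other C : C \in S -> exists2 D, D \in S & C != D.
  move=> CS; have : (0 < #|S :\ C|)%N by move: S1; rewrite (cardsD1 C) CS add1n ltnS.
  by case/card_gt0P => D; rewrite !inE => /andP[DC DS]; exists D => //; rewrite eq_sym.
apply/eqP; rewrite eqEsubset; apply/andP; split.
  have /card_gt0P[C CS] : (0 < #|S|)%N by lia.
  have [D DS CD] := other C CS.
  by rewrite -(SK _ _ CS DS CD) subsetI /core !bigcap_inf.
apply/bigcapsP => C CS; have [D DS CD] := other C CS.
by rewrite -(SK _ _ CS DS CD) subsetIl.
Qed.

(** Two equal petals would both equal [K], which then has at least [t] elements. Otherwise the
    petals are distinct and form a sunflower with core [K]. *)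
Lemma low_core_free_family s t F (a : 'I_s -> {set T}) K : (2 <= s)%N ->
  low_core_free s t F -> (forall j, a j \in F) -> (forall j, t <= #|a j|)%N ->
  (forall j j', j != j' -> a j :&: a j' = K) -> (t <= #|K|)%N.
Proof.
move=> s2 free aF at_ aK; rewrite leqNgt; apply/negP => Kt.
have inj : injective a.
  move=> j j' e; apply/eqP; apply: contraT => jj'.
  by have := at_ j; rewrite -[a j]setIid {2}e aK //; lia.
have cS : #|[set a j | j : 'I_s]| = s by rewrite card_imset // card_ord.
have SK A B : A \in [set a j | j : 'I_s] -> B \in [set a j | j : 'I_s] ->
    A != B -> A :&: B = K.
  by move=> /imsetP[j _ ->] /imsetP[j' _ ->] jj'; apply: aK; apply: contraNneq jj' => ->.
have cE : core [set a j | j : 'I_s] = K by apply: core_pairwise => //; rewrite cS.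
have := free [set a j | j : 'I_s]; rewrite cE leqNgt Kt => H.
suff: false by []; apply: H; first by apply/subsetP => _ /imsetP[j _ ->].
by split=> // A B AS BS AB; rewrite cE SK.
Qed.

Lemma leq_card_cover_sum (I J : finType) (P : {set I}) (Q : {set J})
    (E : J -> {set I}) :
  (forall i, i \in P -> exists2 j, j \in Q & i \in E j) ->
  (#|P| <= \sum_(j in Q) #|E j|)%N.
Proof.
move=> PQ; have -> : (\sum_(j in Q) #|E j| = \sum_(i : I) \sum_(j in Q) (i \in E j))%N.
  by rewrite exchange_big; apply: eq_bigr => j _; rewrite -sum1_card big_mkcond.
rewrite -sum1_card big_mkcond; apply: leq_sum => i _; case: ifP => // /PQ[j jQ ij].
by rewrite (bigD1 j) //= ij.
Qed.

Lemma leq_card_bigcupD1 S B q : (forall C, C \in S -> C != B -> #|C| <= q)%N ->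
  (#|\bigcup_(C in S :\ B) C| <= #|S| * q)%N.
Proof.
move=> Sq; apply: leq_trans (_ : \sum_(C in S :\ B) #|C| <= _)%N.
  by apply: leq_card_cover_sum => x /bigcupP[C CS xC]; exists C.
apply: leq_trans (_ : \sum_(C in S :\ B) q <= _)%N.
  by apply: leq_sum => C; rewrite !inE => /andP[CB CS]; apply: Sq.
by rewrite sum_nat_const leq_mul2r subset_leq_card ?orbT // subsetDl.
Qed.

(* Adding [X] to [F] creates a forbidden sunflower through [X]; every member above [X]
   must meet its other petals outside [X], or it could replace [X] there. *)
Lemma low_core_free_degree s t q F M X i :
  (2 <= s)%N -> (forall A, A \in F -> t <= #|A| <= q)%N -> low_core_free s t F ->
  (forall Y, (t <= #|Y| <= q)%N -> low_core_free s t (Y |: F) -> Y \in F) ->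
  M \subset F -> (forall B C, B \in M -> C \in F -> C \subset B -> C = B) ->
  (t <= #|X| <= i)%N -> (i <= q)%N ->
  (#|[set B in M | (#|B| == i) && (X \subset B)]| <= (s * q) ^ (i - #|X|))%N.
Proof.
move=> s2 Fq free maxF MF minM /andP[tX Xi] iq.
have [d] := ubnP (i - #|X|)%N; elim: d X tX Xi => // d IH X tX Xi di.
set E := [set B in M | _].
have [eXi|Xni] := eqVneq #|X| i.
  have /subset_leq_card : E \subset [set X].
    apply/subsetP => B; rewrite !inE => /and3P[_ /eqP cB XB].
    by rewrite eq_sym eqEcard XB cB eXi leqnn.
  by rewrite cards1 eXi subnn.
have {Xni Xi} Xi : (#|X| < i)%N by rewrite ltn_neqAle Xni.
have [//|big] := leqP #|E| ((s * q) ^ (i - #|X|)).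
have [B0 B0E] : exists B, B \in E by apply/card_gt0P; apply: leq_ltn_trans big.
have XF : X \notin F.
  apply/negP => XF; move: B0E; rewrite inE => /and3P[BM /eqP cB XB].
  by have eX := minM _ _ BM XF XB; move: Xi; rewrite eX cB ltnn.
suff: X \in F by rewrite (negbTE XF).
apply: maxF; first by rewrite tX; lia.
move=> S SXF [cS sunS]; have [XS|XS] := boolP (X \in S); last first.
  apply: free => //; apply/subsetP => B BS.
  have := subsetP SXF B BS; rewrite !inE => /predU1P[eB|//].
  by rewrite -eB BS in XS.
rewrite leqNgt; apply/negP => coreS.
have SF C : C \in S -> C != X -> C \in F.
  by move=> CS CX; have := subsetP SXF C CS; rewrite !inE (negbTE CX).
pose U := \bigcup_(C in S :\ X) C.
have cU : (#|U| <= s * q)%N.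
  rewrite -cS; apply: leq_card_bigcupD1 => C CS CX.
  by have /andP[] := Fq C (SF C CS CX).
have hit B : B \in E -> exists2 y, y \in U :\: X & B \in [set B in M | (#|B| == i) && (y |: X \subset B)].
  rewrite inE => /and3P[BM cB XB].
  have [/exists_inP[y yU yB]|] := boolP [exists y in U :\: X, y \in B].
    by exists y => //; rewrite inE BM cB subUset sub1set yB XB.
  rewrite negb_exists_in => /forall_inP noy; exfalso.
  have BK C : C \in S :\ X -> B :&: C = core S.
    move=> CS; have := CS; rewrite !inE => /andP[CX CS'].
    rewrite -(sunS X C) // 1?eq_sym //; apply/setP => y; rewrite !inE.
    case yC : (y \in C); rewrite ?andbF // !andbT.
    apply/idP/idP => [yB|]; last exact: (subsetP XB).
    apply: contraT => yX; have yU : y \in U :\: X.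
      by rewrite inE yX; apply/bigcupP; exists C.
    by rewrite (negbTE (noy y yU)) in yB.
  have tB : (t <= #|B|)%N by have /andP[] := Fq B (subsetP MF B BM).
  (* If [B] were already a petal, it would equal [core S], which has fewer than [t] elements. *)
  have BS : B \notin S :\ X.
    by apply/negP => /BK; rewrite setIid => eB; move: coreS; rewrite -eB; lia.
  pose S' := B |: (S :\ X).
  have cS' : #|S'| = s by rewrite cardsU1 BS -cS [RHS](cardsD1 X) XS.
  have S'K C D : C \in S' -> D \in S' -> C != D -> C :&: D = core S.
    rewrite !in_setU1 => /predU1P[->|CS] /predU1P[->|DS]; rewrite ?eqxx //.
    - by move=> _; apply: BK.
    - by move=> _; rewrite setIC; apply: BK.
    - by move: CS DS; rewrite !inE => /andP[_ CS] /andP[_ DS]; apply: sunS.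
  have cE : core S' = core S by apply: core_pairwise => //; rewrite cS'.
  have S'F : S' \subset F.
    rewrite subUset sub1set (subsetP MF) //=; apply/subsetP => C.
    by rewrite !inE => /andP[CX CS]; apply: SF.
  have : sunflower s S' by split=> // C D CS DS CD; rewrite cE S'K.
  by move/(free _ S'F); rewrite cE; lia.
suff : (#|E| <= (s * q) ^ (i - #|X|))%N by rewrite leqNgt big.
(* Every member of [E] contains [y |: X] for one of at most [s * q] points [y], and the induction
   applies to each [y |: X]. *)
apply: leq_trans (leq_card_cover_sum hit) _.
apply: leq_trans (_ : \sum_(y in U :\: X) (s * q) ^ (i - #|X|).-1 <= _)%N.
  apply: leq_sum => y; rewrite inE => /andP[yX _].
  have cy : #|y |: X| = #|X|.+1 by rewrite cardsU1 yX.
  have -> : ((i - #|X|).-1 = i - #|y |: X|)%N by rewrite cy; lia.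
  by apply: IH; rewrite cy; lia.
rewrite sum_nat_const -[in leqRHS](ltn_predK (m := 0) (n := i - #|X|)) ?subn_gt0 // expnS.
by rewrite leq_mul2r (leq_trans _ cU) ?orbT // subset_leq_card // subsetDl.
Qed.

(** [F] is enlarged to a maximal admissible [G], and [M] is formed by the inclusion-minimal members
    of [G]: these still lie below every member of [F], and maximality of [G] yields the degree
    bound. *)
Lemma exists_kernel s t q F : (2 <= s)%N ->
  (forall A, A \in F -> t <= #|A| <= q)%N -> low_core_free s t F ->
  exists M, [/\ forall A, A \in M -> (t <= #|A| <= q)%N, low_core_free s t M,
    forall A, A \in F -> exists2 B, B \in M & B \subset A &
    forall X i, (t <= #|X| <= i)%N -> (i <= q)%N ->
      (#|[set B in M | (#|B| == i) && (X \subset B)]| <= (s * q) ^ (i - #|X|))%N].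
Proof.
move=> s2 Fq free.
pose adm F' := `[< (forall A, A \in F' -> t <= #|A| <= q)%N /\ low_core_free s t F' >].
have admF : adm F by apply/asboolP.
have [G /maxsetP[/asboolP[Gq Gfree] maxG] FG] := maxset_exists admF.
pose M := [set B in G | [forall C in G, (C \subset B) ==> (C == B)]].
have MG : M \subset G by apply/subsetP => B; rewrite inE => /andP[].
exists M; split.
- by move=> A /(subsetP MG) /Gq.
- by move=> S SM; apply: Gfree; apply: subset_trans SM MG.
- move=> A /(subsetP FG) AG.
  case: (@arg_minnP _ A (fun C => (C \in G) && (C \subset A)) (fun C => #|C|)) => [|B /andP[BG BA] Bmin]; first by rewrite AG subxx.
  exists B => //; rewrite inE BG; apply/forall_inP => C CG; apply/implyP => CB.
  by rewrite eqEcard CB Bmin // CG (subset_trans CB).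
- move=> X i Xi iq; apply: low_core_free_degree (Gq) (Gfree) _ MG _ Xi iq => //.
    move=> Y tYq freeY; suff <- : Y |: G = G by rewrite setU11.
    apply: maxG; last exact: subsetUr.
    by apply/asboolP; split=> // A; rewrite !inE => /predU1P[->//|]; apply: Gq.
  by move=> B C; rewrite inE => /andP[_ /forall_inP minB] /minB /implyP H /H /eqP.
Qed.

End Sunflowers.

(** * Spread stars and spread cores *)

Section SpreadApproximation.
Variables (R : realType) (T : finType).
Implicit Types (F H S M : {set {set T}}) (A B C K X Y : {set T}) (r : R).

Definition star F X := [set A in F | X \subset A].

Lemma card_starU X Y F :
  #|[set A in star F X | Y \subset A :\: X]| =
    if Y :&: X == set0 then #|star F (X :|: Y)| else 0%N.
Proof.
case: ifP => [/eqP YX|YX].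
  apply: eq_card => A; rewrite !inE subUset subsetD -setI_eq0 YX eqxx andbT.
  by rewrite andbA.
apply/eqP; rewrite cards_eq0; apply/eqP/setP => A; rewrite !inE.
by rewrite subsetD -setI_eq0 YX !andbF.
Qed.

(* Otherwise take [X] maximal with degree above [a ^ (t - |X|) * D ^ (i - t)]: the star
   of [X] is [a]-spread, by maximality up to size [t] and by [D >= a] beyond it. *)
Lemma uniform_low_core_free_bound (a D : R) (s t i L : nat) F :
  (2 <= s)%N -> (t <= i)%N -> (i < 2 ^ L)%N -> uniform i F -> low_core_free s t F ->
  128 * s%:R * (2 * L%:R + 1) <= a <= D ->
  (forall X, (t <= #|X| <= i)%N -> #|star F X|%:R <= D ^+ (i - #|X|)) ->
  #|F|%:R <= a ^+ t * D ^+ (i - t).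
Proof.
move=> s2 ti iL uF free /andP[aL aD] deg; rewrite leNgt; apply/negP => big.
have s0 : 0 < s%:R :> R by rewrite ltr0n; lia.
have L0 : 0 <= L%:R :> R by [].
have a0 : 0 < a by apply: lt_le_trans aL; rewrite mulr_gt0 ?mulr_gt0 //; lra.
have D0 : 0 < D by lra.
pose Q (X : {set T}) := (#|X| <= t)%N && (a ^+ (t - #|X|) * D ^+ (i - t) < #|star F X|%:R).
have Q0 : Q set0.
  rewrite /Q cards0 subn0 leq0n /=.
  suff -> : star F set0 = F by [].
  by apply/setP => A; rewrite inE sub0set andbT.
have [X /andP[Xt QX] maxX] := @arg_maxnP _ set0 Q (fun X => #|X|) Q0.
have {}Xt : (#|X| < t)%N.
  rewrite ltn_neqAle Xt andbT; apply/eqP => eX.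
  by move: QX; rewrite eX subnn mul1r -eX ltNge deg // eX leqnn.
have P0 : (0 < #|star F X|)%N.
  rewrite -(ltr_nat R); apply: le_lt_trans QX.
  by rewrite mulr_ge0 // exprn_ge0 // ltW.
have spr : spread_bound (star F X) (fun A => A :\: X) #|star F X|%:R a.
  move=> Y; rewrite card_starU; case: ifP => [/eqP YX|_]; last by rewrite mul0r.
  have [->|Y0] := eqVneq Y set0.
    by rewrite cards0 expr0 mulr1 setU0.
  have cXY : #|X :|: Y| = (#|X| + #|Y|)%N.
    by rewrite cardsU setIC YX cards0 subn0.
  have {}Y0 : (0 < #|Y|)%N by rewrite card_gt0.
  apply: le_trans (ltW QX).
  have [XYt|XYt] := leqP #|X :|: Y| t.
    have /negP nQ : ~~ Q (X :|: Y).
      by apply/negP => /maxX /=; rewrite cXY; lia.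
    have {nQ} : #|star F (X :|: Y)|%:R <= a ^+ (t - #|X :|: Y|) * D ^+ (i - t).
      by rewrite leNgt; apply/negP => h; apply: nQ; rewrite /Q XYt.
    move=> /(ler_wpM2r (exprn_ge0 #|Y| (ltW a0))) /le_trans; apply.
    rewrite mulrAC -exprD cXY; suff -> : (t - (#|X| + #|Y|) + #|Y| = t - #|X|)%N by [].
    by move: XYt; rewrite cXY; lia.
  have [XYi|XYi] := leqP #|X :|: Y| i; last first.
    suff -> : star F (X :|: Y) = set0.
      by rewrite cards0 mul0r mulr_ge0 // exprn_ge0 // ltW.
    apply/setP => A; rewrite !inE; apply/negP => /andP[AF /subset_leq_card].
    by rewrite (uF A AF); lia.
  have := deg (X :|: Y); rewrite XYi (ltnW XYt) => /(_ isT).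
  move=> /(ler_wpM2r (exprn_ge0 #|Y| (ltW a0))) /le_trans; apply.
  have -> : (#|Y| = (t - #|X|) + (#|X :|: Y| - t))%N by rewrite cXY in XYt *; lia.
  rewrite exprD mulrCA; apply: ler_wpM2l; first by rewrite exprn_ge0 // ltW.
  have -> : (i - t = (i - #|X :|: Y|) + (#|X :|: Y| - t))%N by lia.
  rewrite exprD; apply: ler_wpM2l; first by rewrite exprn_ge0 // ltW.
  by apply: lerXn2r => //; rewrite nnegrE ltW.
(* The members found are disjoint outside [X], so they form a sunflower with core [X], which is
   smaller than [t]. *)
have [|||c [cP cdisj]] := @spread_matching R T _ s L a (star F X) (fun A => A :\: X) _ _ P0 spr.
- lia.
- by [].
- move=> A; rewrite inE => /andP[AF _]; apply: leq_ltn_trans iL.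
  by rewrite -(uF A AF) subset_leq_card // subsetDl.
have cF j : c j \in F by have := cP j; rewrite inE => /andP[].
have Xc j : X \subset c j by have := cP j; rewrite inE => /andP[].
suff: (t <= #|X|)%N by lia.
apply: (low_core_free_family s2 free cF) => [j|j j' /cdisj].
  by rewrite (uF _ (cF j)).
rewrite -setI_eq0 => /eqP/setP dis; apply/setP => x; rewrite inE.
have := dis x; rewrite !inE; case xX: (x \in X) => /=.
  by rewrite !(subsetP (Xc _)).
by [].
Qed.

Definition spread_core r q F B : Prop :=
  (#|B| <= q)%N /\ exists2 H : {set {set T}}, H \subset F &
    [/\ (0 < #|H|)%N, forall A, A \in H -> B \subset A &
        spread_bound H (fun A => A :\: B) #|H|%:R r].

(** For [B] maximal with this concentration, the members of [F'] above [B] are [r]-spread once [B]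
    is removed. If [#|B| <= q], then [B] would be a spread core below an uncovered member. *)
Lemma uncovered_concentrated r q F F' : 0 < r -> F' \subset F -> (0 < #|F'|)%N ->
  (forall A B, A \in F' -> spread_core r q F B -> ~ B \subset A) ->
  exists2 B : {set T}, (q < #|B|)%N & #|F'|%:R <= r ^+ #|B| * #|star F' B|%:R.
Proof.
move=> r0 F'F F'0 unc.
pose Q (B : {set T}) := #|F'|%:R <= r ^+ #|B| * #|star F' B|%:R.
have Q0 : Q set0.
  rewrite /Q cards0 mul1r ler_nat subset_leq_card //.
  by apply/subsetP => A AF; rewrite inE AF sub0set.
have [B QB maxB] := @arg_maxnP _ set0 Q (fun B => #|B|) Q0.
exists B => //; rewrite ltnNge; apply/negP => Bq.
have H0 : (0 < #|star F' B|)%N.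
  have : 0 < r ^+ #|B| * #|star F' B|%:R by apply: lt_le_trans QB; rewrite ltr0n.
  by rewrite pmulr_rgt0 ?exprn_gt0 // ltr0n.
have sc : spread_core r q F B.
  split=> //; exists (star F' B).
    by apply: subset_trans F'F; apply/subsetP => A; rewrite inE => /andP[].
  split=> // [A|Y]; first by rewrite inE => /andP[].
  rewrite card_starU; case: ifP => [/eqP YB|_]; last by rewrite mul0r.
  have [->|Y0] := eqVneq Y set0; first by rewrite cards0 expr0 mulr1 setU0.
  have cBY : #|B :|: Y| = (#|B| + #|Y|)%N by rewrite cardsU setIC YB cards0 subn0.
  have /negP : ~~ Q (B :|: Y).
    apply/negP => /maxB /=; rewrite cBY; have : (0 < #|Y|)%N by rewrite card_gt0.
    lia.
  move/negP; rewrite /Q -ltNge => /ltW /le_trans /(_ QB).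
  by rewrite cBY exprD -mulrA ler_pM2l ?exprn_gt0 // mulrC.
have /card_gt0P[A] := H0; rewrite inE => /andP[AF' BA].
exact: unc AF' sc BA.
Qed.

(** Keep in each witnessing subfamily the members that meet the union [U] of all the cores in their
    own core only. A rainbow matching of what they have outside their cores lifts the family [beta]
    to members of [F] with the same pairwise intersections [K]. The cores are indexed so that they
    may coincide. *)
Lemma spread_core_family (s t q k b L : nat) r F (beta : 'I_s -> {set T}) K :
  (2 <= s)%N -> (t <= k)%N -> uniform k F -> low_core_free s t F ->
  2 * s%:R * q%:R <= r -> 128 * s%:R * b%:R <= r -> (0 < b)%N ->
  (k < 2 ^ L)%N -> (s * 4 ^ L < 2 ^ b)%N ->
  (forall j, spread_core r q F (beta j)) ->
  (forall j j', j != j' -> beta j :&: beta j' = K) -> (t <= #|K|)%N.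
Proof.
move=> s2 tk uF free rq rb b0 kL sb sc bK.
have s0 : 0 < s%:R :> R by rewrite ltr0n; lia.
have b1 : 1 <= b%:R :> R by rewrite ler1n.
have r0 : 0 < r by nra.
pose U := \bigcup_j beta j.
have cU : (#|U| <= s * q)%N.
  apply: leq_trans (_ : \sum_(j in [set: 'I_s]) #|beta j| <= _)%N.
    by apply: leq_card_cover_sum => x /bigcupP[j _ xj]; exists j.
  apply: leq_trans (_ : \sum_(j in [set: 'I_s]) q <= _)%N.
    by apply: leq_sum => j _; case: (sc j).
  by rewrite sum_nat_const cardsT card_ord.
have restrict j : exists H : {set {set T}}, [/\ H \subset F, (0 < #|H|)%N,
    forall A, A \in H -> beta j \subset A, forall A, A \in H -> A :&: U = beta j &
    spread_bound H (fun A => A :\: beta j) #|H|%:R (r / 2)].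
  have [_ [H HF [H0 HB spr]]] := sc j.
  pose G := [set A in H | A :&: U == beta j].
  have bU : beta j \subset U by apply: bigcup_sup.
  (* A discarded member contains some point of [U] outside its core. Each such point lies in at most
     a fraction [1 / r] of [H], and [#|U| <= s * q <= r / 2]. *)
  have half : #|H|%:R <= 2 * #|G|%:R :> R.
    have out : (#|H :\: G| <= \sum_(y in U) #|[set A in H | [set y] \subset A :\: beta j]|)%N.
      apply: leq_card_cover_sum => A; rewrite !inE => /andP[+ AH]; rewrite AH /= => neq.
      have : ~~ (A :&: U \subset beta j).
        by apply: contra neq => sub; rewrite eqEsubset sub subsetI bU HB.
      case/subsetPn => y; rewrite inE => /andP[yA yU] yb.
      by exists y => //; rewrite inE AH sub1set inE yb.
    have h : r * #|H :\: G|%:R <= (s * q)%:R * #|H|%:R.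
      apply: (@le_trans _ _ (\sum_(y in U) #|H|%:R)); last first.
        by rewrite sumr_const -[_ *+ _]mulr_natl ler_wpM2r // ler_nat.
      apply: (@le_trans _ _ (r * (\sum_(y in U) #|[set A in H | [set y] \subset A :\: beta j]|)%N%:R)).
        by rewrite ler_wpM2l ?ler_nat // ltW.
      rewrite natr_sum mulr_sumr; apply: ler_sum => y _.
      by have := spr [set y]; rewrite cards1 expr1 mulrC.
    have eH : #|H|%:R = #|G|%:R + #|H :\: G|%:R :> R.
      rewrite -(cardsID G H) natrD; suff -> : H :&: G = G by [].
      by apply/setIidPr/subsetP => A; rewrite inE => /andP[].
    have : 2 * (r * #|H :\: G|%:R) <= r * #|H|%:R.
      apply: (@le_trans _ _ (2 * ((s * q)%:R * #|H|%:R))).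
        by rewrite ler_wpM2l.
      by rewrite natrM !mulrA ler_wpM2r // -mulrA mulrA.
    by rewrite mulrCA ler_pM2l // eH; lra.
  have GH : G \subset H by apply/subsetP => A; rewrite inE => /andP[].
  exists G; split; first exact: subset_trans GH HF.
  - by rewrite -(ltr_nat R); have : 0 < #|H|%:R :> R; [rewrite ltr0n | lra].
  - by move=> A /(subsetP GH) /HB.
  - by move=> A; rewrite inE => /andP[_ /eqP].
  (* Halving the family loses a factor 2, which replacing [r] by [r / 2] absorbs as soon as [Y] is
     nonempty. *)
  - move=> Y; have [->|Y0] := eqVneq Y set0.
      rewrite cards0 expr0 mulr1 ler_nat subset_leq_card //.
      by apply/subsetP => A; rewrite inE => /andP[].
    have cY : (0 < #|Y|)%N by rewrite card_gt0.
    have : #|[set A in G | Y \subset A :\: beta j]|%:R * r ^+ #|Y| <= 2 * #|G|%:R.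
      apply: le_trans half; apply: le_trans (spr Y).
      rewrite ler_wpM2r ?exprn_ge0 ?(ltW r0) // ler_nat subset_leq_card //.
      by apply/subsetP => A; rewrite !inE -!andbA => /and3P[-> _ ->].
    rewrite exprMn exprVn mulrA ler_pdivrMr ?exprn_gt0 // => /le_trans; apply.
    rewrite mulrC ler_wpM2l // -[leLHS]expr1 ler_weXn2l //; lra.
have {restrict} [P PP] := choice restrict.
have PF j : P j \subset F by case: (PP j).
have [|||j|j|j|a [aP adisj]] :=
  @rainbow_matching R T _ s b L (r / 2) P (fun j A => A :\: beta j).
- by [].
- by move: rb; lra.
- by [].
- by case: (PP j).
- by case: (PP j).
- move=> A AP; apply: leq_ltn_trans kL.
  by rewrite -(uF A (subsetP (PF j) A AP)) subset_leq_card // subsetDl.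
have aF j : a j \in F := subsetP (PF j) _ (aP j).
apply: (low_core_free_family s2 free aF) => [j|j j' jj'].
  by rewrite (uF _ (aF j)).
rewrite -(bK j j' jj').
have ba i : beta i \subset a i by case: (PP i) => _ _ /(_ _ (aP i)).
have aU i x : x \in a i -> x \in U -> x \in beta i.
  by move=> xa xU; case: (PP i) => _ _ _ /(_ _ (aP i)) <- _; rewrite inE xa.
have bU i x : x \in beta i -> x \in U by move=> xb; apply/bigcupP; exists i.
apply/setP => x; rewrite !inE.
apply/andP/andP => [[xj xj']|[xj xj']]; last by rewrite !(subsetP (ba _)).
(* A common point lies in one of the two cores, hence in [U]; as each member meets [U] in its own
   core, the point lies in both cores. *)
have /setP/(_ x) : (a j :\: beta j) :&: (a j' :\: beta j') = set0.
  by apply/eqP; rewrite setI_eq0 adisj.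
rewrite !inE xj xj' !andbT => /negbT; rewrite negb_and !negbK.
by case/orP => xb; split=> //; apply: aU => //; apply: bU xb.
Qed.

End SpreadApproximation.

(** * Counting the members above a given set *)

Section Supersets.
Variable T : finType.
Implicit Types (F : {set {set T}}) (B : {set T}).

Lemma card_star_le F B k : uniform k F -> (#|star F B| <= 'C(#|T| - #|B|, k - #|B|))%N.
Proof.
move=> uF; have -> : (#|T| - #|B| = #|~: B|)%N by rewrite -(cardsC B) addKn.
rewrite -cards_draws -(card_in_imset (f := fun A => A :\: B) (D := star F B)); last first.
  move=> A A'; rewrite !inE => /andP[_ BA] /andP[_ BA'] e.
  by rewrite -(setID A B) -(setID A' B) e (setIidPr BA) (setIidPr BA').
apply: subset_leq_card; apply/subsetP => _ /imsetP[A + ->]; rewrite !inE => /andP[AF BA].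
by rewrite subsetDr cardsD (setIidPr BA) (uF A AF) eqxx.
Qed.

(** The ratio of the two binomials is [(k - y) / (n - y)], at most [k / n]. *)
Lemma bin_sub_mul n k y : (k <= n)%N -> (y < k)%N ->
  (n * 'C(n - y.+1, k - y.+1) <= k * 'C(n - y, k - y))%N.
Proof.
move=> kn yk; have m0 : (0 < n - y)%N by lia.
rewrite -(leq_pmul2l m0) mulnCA.
have -> : (n - y.+1 = (n - y).-1)%N by lia.
have -> : (k - y.+1 = (k - y).-1)%N by lia.
rewrite mul_bin_diag prednK ?subn_gt0 // !mulnA leq_mul2r; apply/orP; right.
by nia.
Qed.

Lemma bin_sub_expn n k t x : (k <= n)%N -> (t + x <= k)%N ->
  (n ^ x * 'C(n - (t + x), k - (t + x)) <= k ^ x * 'C(n - t, k - t))%N.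
Proof.
move=> kn; elim: x => [|x IH] txk; first by rewrite !mul1n addn0.
rewrite !expnS -!mulnA mulnCA addnS.
apply: leq_trans (_ : n ^ x * (k * 'C(n - (t + x), k - (t + x))) <= _)%N.
  by rewrite leq_mul2l bin_sub_mul ?orbT //; lia.
by rewrite mulnCA leq_mul2l IH ?orbT //; lia.
Qed.

Lemma card_star_uniform (R : realType) F B k t :
  uniform k F -> (0 < k <= #|T|)%N -> (t <= #|B|)%N ->
  #|star F B|%:R <= (k%:R / #|T|%:R) ^+ (#|B| - t) * 'C(#|T| - t, k - t)%:R :> R.
Proof.
move=> uF /andP[k0 kT] tB; have T0 : (0 < #|T|)%N by lia.
have [Bk|kB] := leqP #|B| k; last first.
  suff -> : star F B = set0 by rewrite cards0 mulr_ge0 ?exprn_ge0 ?divr_ge0.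
  apply/setP => A; rewrite !inE; apply/negP => /andP[AF /subset_leq_card].
  by rewrite (uF A AF); lia.
rewrite expr_div_n mulrAC ler_pdivlMr ?exprn_gt0 ?ltr0n //.
rewrite -!natrX -!natrM ler_nat mulnC.
have := @bin_sub_expn #|T| k t (#|B| - t) kT; rewrite subnKC // => /(_ Bk) /(leq_trans _); apply.
by rewrite leq_mul2l card_star_le ?orbT.
Qed.

End Supersets.

(** * Weight of the kernel *)

Section Log2.
Variable R : realType.
Implicit Types (x y : R).

Lemma expR_half_le2 : expR 2^-1 <= 2 :> R.
Proof.
have h : (2^-1 : R) <= expR (- 2^-1).
  by apply: le_trans (expR_ge1Dx _); lra.
have e := expRxMexpNx_1 (2^-1 : R); have := expR_ge0 (2^-1 : R).
by move: (expR _) (expR _) h e => b a; nra.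
Qed.

Lemma ln2_ge_half : 2^-1 <= ln (2 : R).
Proof.
rewrite -[leLHS]expRK ler_ln ?posrE ?expR_gt0 //; exact: expR_half_le2.
Qed.

Lemma ler_log2 x y : 0 < x -> x <= y -> log2 x <= log2 y.
Proof.
move=> x0 xy; rewrite /log2 ler_wpM2r ?invr_ge0 //; first by have := ln2_ge_half; lra.
by rewrite ler_ln ?posrE //; lra.
Qed.

Lemma log2X m x : 0 < x -> log2 (x ^+ m) = m%:R * log2 x.
Proof. by move=> x0; rewrite /log2 lnXn // -[ln x *+ m]mulr_natl mulrA. Qed.

Lemma log2_2 : log2 (2 : R) = 1.
Proof. by rewrite /log2 divff //; have := ln2_ge_half; lra. Qed.

Lemma log2_ge_expn m x : 2 ^+ m <= x -> m%:R <= log2 x.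
Proof.
move=> mx; have := ler_log2 (exprn_gt0 m (ltr0n R 2)) mx.
by rewrite log2X // log2_2 mulr1.
Qed.

Lemma log2_le_expn m x : 0 < x -> log2 x <= m%:R -> x <= 2 ^+ m.
Proof.
move=> x0; have l2 : 0 < ln (2 : R) by have := ln2_ge_half; lra.
have -> : m%:R = log2 ((2 : R) ^+ m) by rewrite log2X // log2_2 mulr1.
rewrite /log2 ler_pM2r ?invr_gt0 //.
by rewrite ler_ln ?posrE ?exprn_gt0.
Qed.

Lemma trunc_log_le_log2 m : (0 < m)%N -> (trunc_log 2 m)%:R <= log2 (m%:R : R).
Proof.
by move=> m0; apply: log2_ge_expn; rewrite -natrX ler_nat trunc_logP.
Qed.

Lemma log2_le_nat m : (0 < m)%N -> log2 (m%:R : R) <= m%:R.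
Proof.
move=> m0; have : log2 (m%:R : R) <= log2 (2 ^+ m).
  by apply: ler_log2; rewrite ?ltr0n // -natrX ler_nat ltnW // ltn_expl.
by rewrite log2X // log2_2 mulr1.
Qed.

Lemma log2_ge1 m : (2 <= m)%N -> 1 <= log2 (m%:R : R).
Proof. by move=> m2; rewrite -[leLHS]log2_2 ler_log2 // ler_nat. Qed.

(** With [z = x / t], the bounds [ln (1 + z) <= z] and [ln t >= 1 / 2] give
    [log2 (t + x) <= log2 t * (1 + 2 * z)]; then [(1 + 2 * z) ^ t <= exp (2 * x) <= 16 ^ x]. Thus
    [log2 t] can serve for all sizes above [t]. *)
Lemma log2D_expn (t x : nat) : (2 <= t)%N ->
  log2 ((t + x)%:R : R) ^+ t <= log2 t%:R ^+ t * 16 ^+ x.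
Proof.
move=> t2; have t0 : 0 < t%:R :> R by rewrite ltr0n; lia.
have l2 := ln2_ge_half; have lt1 := log2_ge1 t2.
have x0 : 0 <= x%:R :> R by [].
pose z : R := x%:R / t%:R.
have z0 : 0 <= z by rewrite divr_ge0 // ltW.
have lin : log2 (t + x)%:R <= log2 t%:R * (1 + 2 * z).
  have -> : (t + x)%:R = t%:R * (1 + z) :> R by rewrite natrD /z; field; lra.
  rewrite /log2 lnM ?posrE //; last by lra.
  rewrite mulrAC ler_wpM2r ?invr_ge0 //; first lra.
  have lnt : 2^-1 <= ln (t%:R : R).
    by apply: le_trans l2 _; rewrite ler_ln ?posrE // ler_nat.
  by have := @le_ln1Dx R z; nra.
apply: (@le_trans _ _ ((log2 t%:R * (1 + 2 * z)) ^+ t)).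
  apply: lerXn2r => //; rewrite nnegrE; last by nra.
  by apply: (@le_trans _ _ (log2 t%:R)); [lra | rewrite ler_log2 // ler_nat leq_addr].
rewrite exprMn ler_wpM2l ?exprn_ge0 //; first lra.
apply: (@le_trans _ _ (expR (2 * z) ^+ t)).
  by apply: lerXn2r (expR_ge1Dx _); rewrite nnegrE ?expR_ge0 //; lra.
rewrite -expRM_natr.
have -> : 2 * z * t%:R = 2^-1 * (4 * x)%:R by rewrite natrM /z; field; lra.
rewrite expRM_natr exprM; apply: lerXn2r => //; rewrite ?nnegrE ?exprn_ge0 ?expR_ge0 //.
have -> : 16 = 2 ^+ 4 :> R by rewrite -natrX.
by apply: lerXn2r expR_half_le2; rewrite nnegrE ?expR_ge0.
Qed.

Lemma geometric_sum_le (rho : R) m : 0 <= rho <= 2^-1 ->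
  \sum_(i < m) rho ^+ i.+1 <= 2 * rho.
Proof.
move=> h; elim: m => [|m IH]; first by rewrite big_ord0; lra.
rewrite big_ord_recl expr1.
under eq_bigr => i _ do rewrite exprS.
by rewrite -mulr_sumr; nra.
Qed.

End Log2.

(** * The kernel, size by size *)

Section KernelWeight.
Variables (R : realType) (T : finType) (s t q : nat) (M : {set {set T}}).
Hypotheses (s2 : (2 <= s)%N) (t2 : (2 <= t)%N).
Hypothesis Mq : forall B, B \in M -> (t <= #|B| <= q)%N.
Hypothesis Mfree : low_core_free s t M.
Hypothesis Mdeg : forall (X : {set T}) i, (t <= #|X| <= i)%N -> (i <= q)%N ->
  (#|[set B in M | (#|B| == i) && (X \subset B)]| <= (s * q) ^ (i - #|X|))%N.

Definition level i := [set B in M | #|B| == i].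

(** A sunflower among members of size [t] has a core of at least [t] elements, so all its petals
    equal the core, against [2 <= s]. The level is thus sunflower-free. *)
Lemma level_base : (#|level t| <= phi s t)%N.
Proof.
have [_] := phiP t (ltnW s2); apply; exists T, (level t); split=> //.
  by move=> A; rewrite inE => /andP[_ /eqP].
move=> S SM sunS; have [cS pairS] := sunS.
have uS A : A \in S -> #|A| = t by move=> /(subsetP SM); rewrite inE => /andP[_ /eqP].
have tc : (t <= #|core S|)%N.
  by apply: Mfree => //; apply: subset_trans SM _; apply/subsetP => A; rewrite inE => /andP[].
have [A AS] : exists A, A \in S by apply/card_gt0P; lia.
have [B] : exists B, B \in S :\ A.
  by apply/card_gt0P; have := cardsD1 A S; rewrite AS; lia.
rewrite !inE => /andP[BA BS]; move/eqP: BA; apply.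
have cA : core S = A by apply/eqP; rewrite eqEcard /core bigcap_inf //= uS.
have cB : core S = B by apply/eqP; rewrite eqEcard /core bigcap_inf //= uS.
by rewrite -cA -cB.
Qed.

(** The bound for uniform families is used with [a = 2 ^ 10 * s * log2 i] and [D = 2 ^ 10 * s * q].
    Trading [log2 i] for [log2 t] costs [16 ^ x], which turns [2 ^ 10] into [2 ^ 14]. *)
Lemma level_above x : (t + x <= q)%N ->
  #|level (t + x)%N|%:R <=
    (2 ^+ 10 * s%:R * log2 t%:R) ^+ t * (2 ^+ 14 * s%:R * q%:R) ^+ x :> R.
Proof.
move=> txq; set i := (t + x)%N.
have i2 : (2 <= i)%N by rewrite /i; lia.
have s1 : 1 <= s%:R :> R by rewrite ler1n; lia.
have li1 : 1 <= log2 (i%:R : R) := log2_ge1 R i2.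
have c10 : (2 : R) ^+ 10 = 1024 by rewrite -natrX.
have lev_deg (X : {set T}) : (t <= #|X| <= i)%N -> #|star (level i) X|%:R <= (2 ^+ 10 * s%:R * q%:R) ^+ (i - #|X|) :> R.
  move=> Xi; have := Mdeg Xi txq.
  have -> : [set B in M | (#|B| == i) && (X \subset B)] = star (level i) X.
    by apply/setP => B; rewrite !inE andbA.
  rewrite -(ler_nat R) natrX => /le_trans; apply.
  apply: lerXn2r; rewrite ?nnegrE ?mulr_ge0 ?exprn_ge0 // natrM ler_wpM2r //.
  by rewrite c10; lra.
have := @uniform_low_core_free_bound R T (2 ^+ 10 * s%:R * log2 i%:R) (2 ^+ 10 * s%:R * q%:R)
  s t i (trunc_log 2 i).+1 (level i) s2 (leq_addr _ _) _ _ _ _ lev_deg.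
rewrite addKn => /(_ _ _ _ _)/le_trans; apply.
- exact: trunc_log_ltn.
- by move=> A; rewrite inE => /andP[_ /eqP].
- by move=> S SM; apply: Mfree; apply: subset_trans SM _; apply/subsetP => A; rewrite inE => /andP[].
- apply/andP; split.
    have := trunc_log_le_log2 R (ltnW i2); rewrite -[(trunc_log _ _).+1]addn1 natrD c10.
    by set l := _%:R; nra.
  rewrite ler_wpM2l ?mulr_ge0 ?exprn_ge0 //.
  by apply: le_trans (log2_le_nat R (ltnW i2)) _; rewrite ler_nat.
rewrite [in leRHS](_ : 2 ^+ 14 * s%:R * q%:R = 16 * (2 ^+ 10 * s%:R * q%:R)); last by ring.
have := log2D_expn R x t2; rewrite -/i => h.
have : 0 <= 2 ^+ 10 * s%:R :> R by rewrite mulr_ge0 ?exprn_ge0.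
move: (log2 i%:R) (log2 t%:R) h => li lt h.
move: (2 ^+ 10 * s%:R) => u u0; rewrite !exprMn -!mulrA.
apply: ler_wpM2l; first by rewrite exprn_ge0.
by rewrite [leRHS]mulrA; apply: ler_wpM2r h; rewrite mulr_ge0 ?exprn_ge0.
Qed.

Lemma kernel_weight (kappa : R) : 0 <= kappa ->
  2 ^+ 14 * s%:R * q%:R * kappa <= 2^-1 ->
  \sum_(B in M) kappa ^+ (#|B| - t) <= (phi s t)%:R +
    (2 ^+ 10 * s%:R * log2 t%:R) ^+ t * (2 * (2 ^+ 14 * s%:R * q%:R * kappa)).
Proof.
move=> k0 krho.
(* Members are grouped by their excess [#|B| - t]; it is at most [q], so [inord] loses nothing. The
   groups of positive excess are summed as a geometric series of ratio at most [1 / 2]. *)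
rewrite (partition_big (fun B : {set T} => inord (#|B| - t) : 'I_q.+1) predT) //=.
have inner (j : 'I_q.+1) :
    \sum_(B in M | inord (#|B| - t) == j) kappa ^+ (#|B| - t) = #|level (t + j)%N|%:R * kappa ^+ j.
  rewrite (eq_bigl (fun B => B \in level (t + j)%N)); last first.
    move=> B; rewrite !inE; case BM: (B \in M) => //=; have /andP[tB Bq] := Mq BM.
    apply/eqP/eqP => [<-|->]; first by rewrite inordK; lia.
    by rewrite addKn inord_val.
  rewrite (eq_bigr (fun=> kappa ^+ j)); first by rewrite sumr_const mulr_natl.
  by move=> B; rewrite inE => /andP[_ /eqP ->]; rewrite addKn.
under eq_bigr do rewrite inner.
rewrite big_ord_recl; apply: lerD.
  by rewrite addn0 expr0 mulr1 ler_nat level_base.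
have A0 : 0 <= (2 ^+ 10 * s%:R * log2 t%:R) ^+ t :> R.
  have lt0 : 0 <= log2 (t%:R : R) by have := log2_ge1 R t2; lra.
  by apply/exprn_ge0/mulr_ge0 => //; rewrite mulr_ge0 ?exprn_ge0.
apply: (@le_trans _ _ ((2 ^+ 10 * s%:R * log2 t%:R) ^+ t *
    \sum_(j < q) (2 ^+ 14 * s%:R * q%:R * kappa) ^+ j.+1)); last first.
  rewrite ler_wpM2l // geometric_sum_le // krho andbT.
  by rewrite !mulr_ge0 ?exprn_ge0.
rewrite mulr_sumr; apply: ler_sum => j _; rewrite !lift0 [(_ * kappa) ^+ _]exprMn mulrA.
apply: ler_wpM2r; first by rewrite exprn_ge0.
have [tjq|tjq] := leqP (t + j.+1)%N q; first exact: level_above.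
suff -> : level (t + j.+1)%N = set0.
  by rewrite cards0 mulr_ge0 // exprn_ge0 // !mulr_ge0 ?exprn_ge0.
apply/setP => B; rewrite !inE; apply/negP => /andP[/Mq /andP[_ Bq] /eqP cB].
by lia.
Qed.

End KernelWeight.

(** * The bound for t at least 2 *)

Lemma spread_approximation (R : realType) (T : finType) (s t q k b L : nat) (r : R)
    (F : {set {set T}}) :
  (2 <= s)%N -> (t <= k)%N -> uniform k F -> low_core_free s t F ->
  2 * s%:R * q%:R <= r -> 128 * s%:R * b%:R <= r -> 0 < r -> (0 < b)%N ->
  (k < 2 ^ L)%N -> (s * 4 ^ L < 2 ^ b)%N ->
  exists (G F' : {set {set T}}),
  [/\ low_core_free s t G, forall B, B \in G -> (t <= #|B| <= q)%N, F' \subset F,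
    forall A, A \in F -> A \in F' \/ exists2 B, B \in G & B \subset A &
    (0 < #|F'|)%N -> exists2 B : {set T}, (q < #|B|)%N &
      #|F'|%:R <= r ^+ #|B| * #|star F' B|%:R].
Proof.
move=> s2 tk uF free rq rb r0 b0 kL sb.
pose G := [set B : {set T} | `[< spread_core r q F B >]].
have GP B : B \in G -> spread_core r q F B by rewrite inE => /asboolP.
pose F' := [set A in F | ~~ [exists B in G, B \subset A]].
have F'F : F' \subset F by apply/subsetP => A; rewrite inE => /andP[].
exists G, F'; split=> //.
- move=> S SG [cS pairS].
  pose beta (j : 'I_s) := enum_val (cast_ord (esym cS) j).
  have bS j : beta j \in S := enum_valP _.
  apply: (spread_core_family (beta := beta) s2 tk uF free rq rb b0 kL sb).
    by move=> j; apply: GP; apply: (subsetP SG).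
  move=> j j' jj'; apply: pairS => //; apply: contraNneq jj' => /enum_val_inj/cast_ord_inj ->.
  exact: eqxx.
- move=> B BG; have [Bq _] := GP B BG; rewrite Bq andbT.
  (* Repeating [B] itself [s] times, with [K = B], shows that a spread core has at least [t]
     elements. *)
  apply: (spread_core_family (beta := fun=> B) s2 tk uF free rq rb b0 kL sb).
    by move=> _; apply: GP.
  by move=> j j' _; rewrite setIid.
- move=> A AF; case: (boolP [exists B in G, B \subset A]) => [/exists_inP[B BG BA]|no].
    by right; exists B.
  by left; rewrite inE AF.
- move=> F'0; apply: uncovered_concentrated r0 F'F F'0 _ => A B.
  rewrite inE => /andP[_ /negP no] sc BA; apply: no; apply/exists_inP; exists B => //.
  by rewrite inE; apply/asboolP.
Qed.

Lemma low_core_free_bound (R : realType) (s t n k : nat) (F : {set {set 'I_n}}) :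
  (2 <= s)%N -> (2 <= t)%N -> (t <= k)%N ->
  2 ^+ 18 * s%:R * (t + 1)%:R * log2 (n%:R / k%:R) <= n%:R / k%:R :> R ->
  2 ^+ 15 * s%:R * k%:R * log2 k%:R <= n%:R :> R ->
  uniform k F -> low_core_free s t F ->
  #|F|%:R <=
    (phi s t)%:R * 'C(n - t, k - t)%:R
    + (2 ^+ 14 * s%:R * log2 t%:R) ^+ t
      * ((2 ^+ 19 * s%:R * (t + 1)%:R * log2 (n%:R / k%:R)) / (n%:R / k%:R))
      * 'C(n - t, k - t)%:R :> R.
Proof.
move=> s2 t2 tk hnk hnklog uF free.
have k2 : (2 <= k)%N by lia.
have s2R : 2 <= s%:R :> R by rewrite ler_nat.
have t2R : 3 <= (t + 1)%:R :> R by rewrite ler_nat; lia.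
have k0 : 0 < k%:R :> R by rewrite ltr0n; lia.
have lk1 : 1 <= log2 (k%:R : R) := log2_ge1 R k2.
pose nu : R := n%:R / k%:R.
have nulk : 2 ^+ 15 * s%:R * log2 k%:R <= nu.
  by rewrite ler_pdivlMr // mulrAC.
have nu16 : 2 ^+ 16 <= nu.
  apply: le_trans nulk; rewrite [2 ^+ 16]exprSr -mulrA ler_wpM2l ?exprn_ge0 //.
  by move: (log2 _) lk1 => l; nra.
have nu0 : 0 < nu by apply: lt_le_trans nu16; rewrite exprn_gt0.
pose lam := log2 nu; rewrite -/nu -/lam in hnk *.
have lam16 : 16 <= lam := log2_ge_expn nu16.
have lamE : lam = log2 nu by [].
clearbody lam.
pose P := s%:R * (t + 1)%:R * lam.
have P96 : 96 <= P.
  have : 6 <= s%:R * (t + 1)%:R :> R by nra.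
  by rewrite /P; move: (s%:R * _) => z; nra.
have hP : 2 ^+ 18 * P <= nu by rewrite /P !mulrA.
have slam : 3 * (s%:R * lam) <= P.
  by rewrite /P mulrCA -mulrA; apply: ler_wpM2l => //; apply: ler_wpM2r => //; lra.
(* All larger powers of two are expressed through [e], which is then kept abstract with the lower
   bound [32 * 32]. *)
pose e : R := 2 ^+ 14.
have c15 : (2 : R) ^+ 15 = 2 * e by rewrite exprS.
have c18 : (2 : R) ^+ 18 = 16 * e by rewrite (exprD _ 4 14) -/e -natrX.
have c19 : (2 : R) ^+ 19 = 32 * e by rewrite (exprD _ 5 14) -/e -natrX.
have e10 : 2 ^+ 10 <= e by rewrite ler_weXn2l //; lra.
have lt1 : 1 <= log2 (t%:R : R) := log2_ge1 R t2.
have hA : (2 ^+ 10 * s%:R * log2 t%:R) ^+ t <= (e * s%:R * log2 t%:R) ^+ t.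
  have sl0 : 0 <= s%:R * log2 t%:R :> R by apply: mulr_ge0 => //; lra.
  have c0 : 0 <= (2 : R) ^+ 10 by rewrite exprn_ge0.
  rewrite -![_ * s%:R * _]mulrA; apply: lerXn2r.
  - by rewrite nnegrE; apply: mulr_ge0.
  - by rewrite nnegrE; apply: mulr_ge0 => //; apply: le_trans e10.
  - exact: ler_wpM2r.
have A1 : 1 <= (2 ^+ 10 * s%:R * log2 t%:R) ^+ t :> R.
  have c10 : 1 <= (2 : R) ^+ 10 by rewrite exprn_ege1 //; lra.
  apply: exprn_ege1; move: (2 ^+ 10) (log2 _) c10 lt1 => c l c1 l1.
  by have : 1 <= c * s%:R; nra.
have kw := @kernel_weight R 'I_n s t; rewrite -/e in kw.
have e1024 : 32 * 32 <= e.
  by apply: le_trans e10; rewrite (exprD _ 5 5) -natrX.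
have nu1 : 1 <= nu by apply: le_trans nu16; rewrite exprn_ege1 //; lra.
rewrite c19; rewrite c15 in nulk; rewrite c18 in hP; rewrite -/e.
move: kw hA A1; set a := (2 ^+ 10 * _ * _) ^+ t; set a' := (e * _ * _) ^+ t => kw hA A1.
clearbody e a a'; clear c15 c18 c19 hnk hnklog nu16 e10.
have e0 : 0 <= e by lra.
have P0 : 0 <= P by lra.
have {}nulk : 32 * 32 * (s%:R * log2 k%:R) <= nu.
  apply: le_trans nulk; rewrite -[leRHS]mulrA; apply: ler_wpM2r; last by lra.
  by apply: mulr_ge0 => //; lra.
have hP2 : 32 * 32 * P <= nu.
  by apply: le_trans hP; rewrite ler_wpM2r //; lra.
have logs : log2 (s%:R : R) <= lam.
  rewrite lamE; apply: ler_log2; first lra.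
  by have : s%:R <= s%:R * lam; [rewrite ler_peMr //; lra | lra].
pose Lam := (t + 1)%:R * lam.
have Lam0 : 0 <= Lam by rewrite /Lam; nra.
(* Rounding down still gives [Lam <= #|B|] for every [B] with more than [q] elements, that is
   [nu ^ (t + 1) <= 2 ^ #|B|]. *)
pose q := Num.trunc Lam.
have /andP[qLam Lamq] : q%:R <= Lam < q.+1%:R by exact: truncn_itv.
have sqP : s%:R * q%:R <= P by rewrite /P -mulrA ler_wpM2l.
(* [2 ^ b = 4 ^ L * 2 ^ L'] exceeds [s * 4 ^ L], as the rainbow matching requires. *)
pose L := (trunc_log 2 k).+1; pose L' := (trunc_log 2 s).+1; pose b := (2 * L + L')%N.
have kL : (k < 2 ^ L)%N by exact: trunc_log_ltn.
have sL' : (s < 2 ^ L')%N by exact: trunc_log_ltn.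
have sb : (s * 4 ^ L < 2 ^ b)%N.
  by rewrite expnD expnM mulnC ltn_pmul2l // expn_gt0.
have b0 : (0 < b)%N by rewrite /b addn_gt0 orbT.
pose r := nu / 2.
have rq : 2 * s%:R * q%:R <= r by rewrite /r -mulrA; lra.
(* The hypothesis on [log2 k] pays for the part [2 * L] of [b], and the one on [log2 (n / k)] for
   [L'], through [log2 s <= lam]. *)
have rb : 128 * s%:R * b%:R <= r.
  have bR : b%:R <= 2 * log2 k%:R + lam + 3 :> R.
    rewrite /b /L /L' natrD natrM -!natr1.
    have := trunc_log_le_log2 R (ltnW k2); have := trunc_log_le_log2 R (ltnW s2); lra.
  apply: (@le_trans _ _ (128 * s%:R * (2 * log2 k%:R + lam + 3))).
    by rewrite ler_wpM2l // mulr_ge0 //; lra.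
  have : s%:R <= s%:R * lam by rewrite ler_peMr //; lra.
  rewrite /r; move: nulk hP2 slam.
  by move: (log2 k%:R) => l; lra.
have r0 : 0 < r by rewrite /r; lra.
have [G [F' [Gfree Gq F'F cover F'conc]]] :=
  spread_approximation s2 tk uF free rq rb r0 b0 kL sb.
have [M [Mq Mfree MG Mdeg]] := exists_kernel s2 Gq Gfree.
pose kappa : R := k%:R / n%:R.
have kappaE : kappa = nu^-1 by rewrite /kappa /nu invf_div.
have kap0 : 0 < kappa by rewrite kappaE invr_gt0.
have hPk : 16 * e * P * kappa <= 1 by rewrite kappaE ler_pdivrMr // mul1r.
have kn : (0 < k <= #|'I_n|)%N.
  rewrite card_ord; apply/andP; split; first exact: ltnW.
  rewrite -(ler_nat R); by move: nu1; rewrite /nu ler_pdivlMr // mul1r.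
clearbody nu.
pose Cb : R := 'C(n - t, k - t)%:R; rewrite -/Cb.
have Cb0 : 0 <= Cb by rewrite /Cb.
have starF (B : {set 'I_n}) (H : {set {set 'I_n}}) : H \subset F -> (t <= #|B|)%N -> #|star H B|%:R <= kappa ^+ (#|B| - t) * Cb.
  move=> HF tB; have uH : uniform k H by move=> A /(subsetP HF) /uF.
  by have := card_star_uniform R uH kn tB; rewrite card_ord.
have F'small : #|F'|%:R <= kappa * Cb.
  have [->|F'0] := posnP #|F'|; first by rewrite mulr_ge0 // ltW.
  have [B qB] := F'conc F'0; move=> /le_trans; apply.
  have LamB : Lam <= #|B|%:R by apply: le_trans (ltW Lamq) _; rewrite ler_nat.
  have tB : (t <= #|B|)%N.
    rewrite -(ler_nat R); apply: le_trans LamB; apply: (@le_trans _ _ (t + 1)%:R).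
      by rewrite ler_nat leq_addr.
    by rewrite /Lam; apply: ler_peMr => //; apply: le_trans lam16; rewrite ler1n.
  have pw : nu ^+ t.+1 <= 2 ^+ #|B|.
    apply: log2_le_expn; first by rewrite exprn_gt0.
    by rewrite log2X // -lamE -addn1.
  (* As [r = nu / 2] and [kappa = 1 / nu], the factor of [Cb] equals [nu ^ t / 2 ^ #|B|], which is
     at most [1 / nu] by [pw]. *)
  apply: (@le_trans _ _ (r ^+ #|B| * (kappa ^+ (#|B| - t) * Cb))).
    by apply: ler_wpM2l; [exact/exprn_ge0/ltW | exact: starF].
  rewrite mulrA ler_wpM2r // kappaE /r.
  rewrite exprVn ler_pdivrMr ?exprn_gt0 // -(ler_pM2l (exprn_gt0 t.+1 nu0)).
  rewrite expr_div_n [leLHS]mulrA ler_pdivrMr ?exprn_gt0 //.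
  have -> : nu ^+ t.+1 * (nu^-1 * nu ^+ (#|B| - t)) * 2 ^+ #|B| = nu ^+ #|B| * 2 ^+ #|B|.
    by rewrite exprS mulrACA divff ?gt_eqF // mul1r -exprD subnKC.
  by rewrite mulrC ler_pM2l ?exprn_gt0.
have cardF : #|F|%:R <= #|F'|%:R + \sum_(B in M) #|star F B|%:R :> R.
  have sub : (#|F :\: F'| <= \sum_(B in M) #|star F B|)%N.
    apply: leq_card_cover_sum => A; rewrite inE => /andP[AF' AF].
    have [|[B /MG[C CM CB] BA]] := cover A AF; first by rewrite (negbTE AF').
    by exists C => //; rewrite inE AF (subset_trans CB).
  rewrite -natr_sum -natrD ler_nat -(cardsID F' F) leq_add //.
  by rewrite subset_leq_card // subsetIr.
have sum_le : #|F|%:R <= kappa * Cb + (\sum_(B in M) kappa ^+ (#|B| - t)) * Cb.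
  apply: (le_trans cardF); apply: lerD => //; rewrite mulr_suml.
  by apply: ler_sum => B BM; apply: starF => //; have /andP[] := Mq B BM.
have ePk : 0 <= e * P * kappa by apply: mulr_ge0 (ltW kap0); apply: mulr_ge0.
have eqk : e * s%:R * q%:R * kappa <= e * P * kappa.
  apply: ler_wpM2r; first exact: ltW.
  by rewrite -[leLHS]mulrA; apply: ler_wpM2l.
have weight : \sum_(B in M) kappa ^+ (#|B| - t) <= (phi s t)%:R + a * (2 * (e * P * kappa)).
  apply: le_trans (kw q M s2 t2 Mq Mfree Mdeg kappa (ltW kap0) _) _; first by lra.
  by rewrite lerD2l !ler_wpM2l //; lra.
have kePk : kappa <= e * P * kappa.
  by rewrite ler_peMl ?(ltW kap0) //; nra.
(* The uncovered members are absorbed by the slack between the constants 2 and 32. *)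
have final : kappa + a * (2 * (e * P * kappa)) <= a' * (32 * (e * P * kappa)).
  by move: (e * P * kappa) ePk kePk => y y0 ky; nra.
apply: (le_trans sum_le); rewrite -!mulrDl.
apply: ler_wpM2r => //.
have -> : 32 * e * s%:R * (t + 1)%:R * lam / nu = 32 * (e * P * kappa).
  by rewrite kappaE /P; ring.
by lra.
Qed.

(** * Pairwise disjoint members: the case t = 1 *)

Section Matchings.
Local Open Scope nat_scope.

Lemma nth_sorted_ltn_gap (l : seq nat) x y : sorted ltn l -> x <= y -> y < size l ->
  nth 0 l x + (y - x) <= nth 0 l y.
Proof.
move=> sl xy; rewrite -{1 3}(subnKC xy); elim: (y - x) => [|d IH] dl; first by rewrite !addn0.
have d'l : x + d < size l by lia.
have := IH d'l; suff : nth 0 l (x + d) < nth 0 l (x + d.+1) by lia.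
by apply: (sorted_ltn_nth ltn_trans) => //; rewrite ?inE //; lia.
Qed.

Lemma exists_subset_card (T : finType) (A : {set T}) m : m <= #|A| ->
  exists2 B : {set T}, B \subset A & #|B| = m.
Proof.
move=> mA; have : 0 < #|[set B : {set T} | B \subset A & #|B| == m]|.
  by rewrite cards_draws bin_gt0.
by case/card_gt0P => B; rewrite inE => /andP[BA /eqP cB]; exists B.
Qed.

Variable n : nat.
Implicit Types (A B : {set 'I_n.+1}).

(** The subtraction is modulo [n + 1]: these are [k] consecutive points of the cycle, starting at
    [a], when [k <= n + 1]. *)
Definition arc k (a : 'I_n.+1) := [set x : 'I_n.+1 | (x - a)%R < k].

Lemma card_arc k a : k <= n.+1 -> #|arc k a| = k.
Proof.
move=> kn; rewrite -(card_imset _ (GRing.addIr (- a)%R)).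
have -> : [set (x - a)%R | x in arc k a] = [set widen_ord kn i | i : 'I_k].
  apply/setP => y; apply/imsetP/imsetP => [[x + ->]|[i _ ->]].
    by rewrite inE => xk; exists (Ordinal xk) => //; apply: val_inj.
  by exists (widen_ord kn i + a)%R; rewrite ?inE GRing.addrK /=.
by rewrite card_imset ?card_ord // => i j /(congr1 val) /= e; apply: val_inj.
Qed.

(** The hypotheses bound the two gaps between the starting points, the second one across the wrap
    from [n] to 0. *)
Lemma arc_disjoint k (a b : 'I_n.+1) : a + k <= b -> b + k <= a + n.+1 ->
  [disjoint arc k a & arc k b].
Proof.
move=> ab ba; rewrite -setI_eq0; apply/eqP/setP => x; rewrite !inE.
have val_sub (c : 'I_n.+1) : (x - c)%R = (if c <= x then x - c else x + n.+1 - c) :> nat.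
  have xn := ltn_ord x; have cn := ltn_ord c.
  rewrite /= modnDmr; case: (leqP c x) => cx.
    by rewrite addnBA ?(ltnW cn) // addnC -addnBA // modnDl modn_small //; lia.
  by rewrite modn_small //; lia.
rewrite !val_sub; have := ltn_ord x; have := ltn_ord b.
by case: (leqP a x) => ?; case: (leqP b x) => ? ? ?; apply/negbTE/negP => /andP[]; lia.
Qed.

Lemma exists_disjoint_arcs s k A : 0 < k -> s * k <= n.+1 -> s.-1 * k < #|A| ->
  exists c : 'I_s -> 'I_n.+1, (forall j, c j \in A) /\
    (forall j j', j != j' -> [disjoint arc k (c j) & arc k (c j')]).
Proof.
move=> k0 skn cA.
(* [A] is trimmed or padded to exactly [s * k] points; padding adds fewer than [k]. *)
have [B cB BA] : exists2 B : {set 'I_n.+1}, #|B| = s * k & #|B :\: A| < k.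
  have [Ask|skA] := leqP #|A| (s * k); last first.
    have [B BA cB] := exists_subset_card (ltnW skA).
    by exists B => //; move: BA; rewrite -setD_eq0 => /eqP ->; rewrite cards0.
  have [C CA cC] : exists2 C : {set 'I_n.+1}, C \subset ~: A & #|C| = s * k - #|A|.
    by apply: exists_subset_card; have := cardsC A; rewrite card_ord; lia.
  have AC0 : A :&: C = set0.
    by apply/eqP; rewrite setI_eq0 disjoint_sym disjoints_subset.
  have cAC : #|A :|: C| = s * k by rewrite cardsU AC0 cards0 cC; lia.
  exists (A :|: C) => //.
  rewrite setDUl setDv set0U (leq_ltn_trans (subset_leq_card (subsetDl _ _))) // cC.
  by have : s * k <= s.-1 * k + k; [case: (s) => [|?] /=; lia | lia].
(* Listing [B] in increasing order as [b], the points [b j, b (k + j), b (2 k + j), ...]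
   start disjoint arcs, and [B :\: A] is too small to meet all [k] of these classes. *)
pose l := [seq val i | i <- enum B].
have sl : size l = s * k by rewrite size_map -cardE.
have ul : uniq l by rewrite map_inj_uniq ?enum_uniq //; apply: val_inj.
have sortl : sorted ltn l.
  have eB : enum B = filter (mem B) (enum 'I_n.+1) by rewrite [enum 'I_n.+1]enumT.
  rewrite sorted_map eB; apply: sorted_filter; first by move=> ? ? ?; apply: ltn_trans.
  by rewrite -sorted_map val_enum_ord iota_ltn_sorted.
pose b i : 'I_n.+1 := inord (nth 0 l i).
have bP i : i < s * k -> b i \in B /\ b i = nth 0 l i :> nat.
  move=> ik; have : nth 0 l i \in l by rewrite mem_nth // sl.
  by case/mapP => x; rewrite mem_enum /b => xB ->; rewrite inord_val.
have idx (m : 'I_s) (j : 'I_k) : m * k + j < s * k.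
  have := ltn_ord j; have : m.+1 * k <= s * k by rewrite leq_mul2r ltn_ord orbT.
  by rewrite mulSn; lia.
have [/existsP[j /forallP jA]|] := boolP [exists j : 'I_k, forall m : 'I_s, b (m * k + j) \in A].
  exists (fun m => b (m * k + j)); split=> // m m'.
  wlog lt_mm' : m m' / m < m' => [wl|_].
    rewrite neq_ltn => /orP[lt|lt]; first by apply: wl => //; rewrite neq_ltn lt.
    by rewrite disjoint_sym; apply: wl => //; rewrite neq_ltn lt.
  have [_ e] := bP _ (idx m j); have [_ e'] := bP _ (idx m' j).
  have last_lt : (s * k).-1 < s * k by have := idx m j; lia.
  have [_ el] := bP _ last_lt; have := ltn_ord (b (s * k).-1); rewrite el => bl.
  have kmm' : m * k + k <= m' * k by rewrite -mulSnr leq_mul2r lt_mm' orbT.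
  have kms : m' * k + k <= s * k by rewrite -mulSnr leq_mul2r ltn_ord orbT.
  have jk := ltn_ord j.
  (* [g1] separates the two starts by at least [k]; [g2] and [g3] together leave the required room
     across the wrap. *)
  have g1 := @nth_sorted_ltn_gap l (m * k + j) (m' * k + j) sortl.
  have g2 := @nth_sorted_ltn_gap l (m' * k + j) (s * k).-1 sortl.
  have g3 := @nth_sorted_ltn_gap l 0 (m * k + j) sortl.
  rewrite sl in g1 g2 g3.
  have {}g1 := g1 ltac:(lia) (idx _ _).
  have {}g2 := g2 ltac:(lia) ltac:(lia).
  have {}g3 := g3 ltac:(lia) (idx _ _).
  by apply: arc_disjoint; rewrite e e'; lia.
rewrite negb_exists => /forallP no.
have /fin_all_exists[m mP] : forall j : 'I_k, exists m : 'I_s, b (m * k + j) \notin A.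
  by move=> j; move: (no j); rewrite negb_forall => /existsP.
suff : k <= #|B :\: A| by rewrite leqNgt BA.
have inj : injective (fun j : 'I_k => b (m j * k + j)).
  move=> j j' /(congr1 val) /=.
  have [_ ->] := bP _ (idx (m j) j); have [_ ->] := bP _ (idx (m j') j').
  move/eqP; rewrite nth_uniq ?sl ?idx // => /eqP /(congr1 (modn^~ k)).
  by rewrite !modnMDl !modn_small // => e; apply: val_inj.
rewrite -[X in X <= _]card_ord -(card_imset _ inj); apply: subset_leq_card.
apply/subsetP => _ /imsetP[j _ ->]; rewrite inE mP.
by have [] := bP _ (idx (m j) j).
Qed.

Definition arc_count k A :=
  #|[set u : {perm 'I_n.+1} * 'I_n.+1 | u.1 @: arc k u.2 == A]|.

(** Composition with [p] permutes the pairs being counted. *)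
Lemma arc_count_perm k A (p : {perm 'I_n.+1}) : arc_count k (p @: A) = arc_count k A.
Proof.
pose f (u : {perm 'I_n.+1} * 'I_n.+1) := ((u.1 * p)%g, u.2).
have finj : injective f.
  by move=> [u a] [v c] e; have /= /mulIg -> := congr1 fst e; have /= -> := congr1 snd e.
rewrite /arc_count -[RHS](card_imset _ finj); apply: eq_card => -[u a].
rewrite inE /=; apply/eqP/imsetP => [e|[[v c]]].
  exists ((u * p^-1)%g, a); last by rewrite /f /= mulgKV.
  rewrite inE /=; apply/eqP/(imset_inj (@perm_inj _ p)); rewrite -e -imset_comp.
  by apply: eq_imset => x; rewrite /= permM permKV.
rewrite inE /= => /eqP <- [-> ->]; rewrite -imset_comp.
by apply: eq_imset => x; rewrite /= permM.
Qed.

(** A transposition exchanging a point of [A :\: B] with one of [B :\: A] brings [A] closer to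
    [B]. *)
Lemma arc_count_card k A B : #|A| = #|B| -> arc_count k A = arc_count k B.
Proof.
have [d] := ubnP #|A :\: B|; elim: d A => // d IH A dA cAB.
have [/eqP|/card_gt0P[x]] := posnP #|A :\: B|.
  by rewrite cards_eq0 setD_eq0 => AB; have /eqP -> : A == B by rewrite eqEcard AB cAB leqnn.
rewrite inE => /andP[xB xA].
have /card_gt0P[y] : 0 < #|B :\: A|.
  have := cardsID B A; have := cardsID A B; rewrite setIC.
  have : 0 < #|A :\: B| by apply/card_gt0P; exists x; rewrite inE xB.
  by rewrite setIC; lia.
rewrite inE => /andP[yA yB].
rewrite -(arc_count_perm k A (tperm x y)); apply: IH; last first.
  by rewrite card_imset //; apply: perm_inj.
suff sub : (tperm x y @: A) :\: B \subset (A :\: B) :\ x.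
  rewrite (leq_ltn_trans (subset_leq_card sub)) //; move: dA.
  by rewrite (cardsD1 x (A :\: B)) inE xB xA; lia.
apply/subsetP => z; rewrite inE => /andP[zB /imsetP[w wA ez]]; move: zB; rewrite ez.
case: tpermP => [_|ew|/eqP wx /eqP wy] zB; rewrite ?yB // in zB *.
  by rewrite ew (negbTE yA) in wA.
by rewrite !inE wx zB wA.
Qed.

(** Under each permutation at most [s.-1 * k] arcs land in [F], since more would contain [s]
    disjoint ones. Each [k]-set is hit equally often, namely [c] times; counting all [k]-sets
    determines [c], and the diagonal identity for binomials finishes. *)
Lemma matching_free_bound s k (F : {set {set 'I_n.+1}}) :
  2 <= s -> 0 < k -> s * k <= n.+1 -> uniform k F -> low_core_free s 1 F ->
  #|F| <= s.-1 * 'C(n, k.-1).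
Proof.
move=> s2 k0 skn uF free.
have kn : k <= n.+1 by nia.
have circle (p : {perm 'I_n.+1}) : #|[set a | p @: arc k a \in F]| <= s.-1 * k.
  rewrite leqNgt; apply/negP => /(exists_disjoint_arcs k0 skn)[c [cF cdisj]].
  suff: 1 <= #|@set0 'I_n.+1| by rewrite cards0.
  apply: (low_core_free_family (a := fun j => p @: arc k (c j)) s2 free) => [j|j|j j' /cdisj].
  - by have := cF j; rewrite inE.
  - by rewrite card_imset ?card_arc //; apply: perm_inj.
  by rewrite -setI_eq0 -imsetI; [move=> /eqP ->; rewrite imset0 | move=> ? ? _ _; apply: perm_inj].
have [C0 _ cC0] : exists2 C0 : {set 'I_n.+1}, C0 \subset setT & #|C0| = k.
  by apply: exists_subset_card; rewrite cardsT card_ord.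
pose c := arc_count k C0.
have cE (A : {set 'I_n.+1}) : #|A| = k -> arc_count k A = c.
  by move=> cA; apply: arc_count_card; rewrite cA cC0.
have sumc (Q : {set {set 'I_n.+1}}) : uniform k Q ->
    #|Q| * c = \sum_(p : {perm 'I_n.+1}) #|[set a | p @: arc k a \in Q]|.
  move=> uQ; rewrite -sum_nat_const.
  rewrite (eq_bigr (fun A => \sum_(u : {perm 'I_n.+1} * 'I_n.+1) (u.1 @: arc k u.2 == A))); last first.
    move=> A AQ; rewrite -(cE A (uQ A AQ)) /arc_count -sum1_card big_mkcond.
    by apply: eq_bigr => u _; rewrite inE.
  rewrite exchange_big /= -(pair_bigA _ (fun (p : {perm 'I_n.+1}) a => \sum_(A in Q) (p @: arc k a == A))) /=.
  apply: eq_bigr => p _; rewrite -sum1_card [RHS]big_mkcond; apply: eq_bigr => a _.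
  rewrite inE; case: ifP => [pQ|pQ].
    rewrite (bigD1 (p @: arc k a)) //= eqxx big1 // => A /andP[_].
    by rewrite eq_sym => /negbTE ->.
  by rewrite big1 // => A AQ; case: eqP => // e; rewrite -e pQ in AQ.
have uall : uniform k [set A : {set 'I_n.+1} | #|A| == k] by move=> A; rewrite inE => /eqP.
have total : 'C(n.+1, k) * c = #|{perm 'I_n.+1}| * n.+1.
  have := sumc _ uall; rewrite (_ : #|[set A : {set 'I_n.+1} | #|A| == k]| = 'C(n.+1, k)).
    move=> ->; rewrite -[RHS]sum_nat_const; apply: eq_bigr => p _.
    rewrite -[RHS]card_ord -cardsT; apply: eq_card => a; rewrite !inE.
    by rewrite card_imset ?card_arc ?eqxx //; apply: perm_inj.
  by rewrite card_draws card_ord.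
have FC : #|F| * c <= #|{perm 'I_n.+1}| * (s.-1 * k).
  by rewrite (sumc _ uF) -sum_nat_const; apply: leq_sum => p _.
have perm0 : 0 < #|{perm 'I_n.+1}| by apply/card_gt0P; exists 1%g.
have diag := mul_bin_diag n.+1 k.-1; rewrite /= prednK // in diag.
have n0 : 0 < #|{perm 'I_n.+1}| * n.+1 by rewrite muln_gt0 perm0.
rewrite -(leq_pmul2r n0) -total mulnCA.
apply: leq_trans (_ : 'C(n.+1, k) * (#|{perm 'I_n.+1}| * (s.-1 * k)) <= _).
  by rewrite leq_mul2l FC orbT.
by rewrite total; move: diag; nia.
Qed.

End Matchings.

(** * The case t = 1 completed, and the theorem *)

Lemma phi1_ge s : (0 < s)%N -> (s.-1 <= phi s 1)%N.
Proof.
move=> s0; have [_] := phiP 1 s0; apply.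
have cF : #|[set [set x] | x : 'I_s.-1]| = s.-1.
  by rewrite card_imset ?card_ord //; apply: set1_inj.
exists 'I_s.-1, [set [set x] | x : 'I_s.-1]; split=> //.
  by move=> _ /imsetP[x _ ->]; rewrite cards1.
by move=> S /subset_leq_card; rewrite cF => cS [eS _]; move: cS; rewrite eS; lia.
Qed.

(** For [k = 1] the first inequality gives the claim, for [k >= 2] the second. When [n = k = 1] both
    logarithms vanish and [s] is unrestricted, so this case is excluded. *)
Lemma ground_set_large (R : realType) (s n k : nat) : (0 < s)%N -> (0 < k)%N ->
  (n = 1 -> k != 1)%N ->
  2 ^+ 18 * s%:R * (1 + 1)%:R * log2 (n%:R / k%:R) <= n%:R / k%:R :> R ->
  2 ^+ 15 * s%:R * k%:R * log2 k%:R <= n%:R :> R -> (0 < n)%N -> (s * k <= n)%N.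
Proof.
move=> s0 k0 nk hnk hnklog n0; rewrite -(ler_nat R) natrM.
have s1 : 0 <= s%:R :> R by [].
have [k1|k2] := leqP k 1.
  have {k0 k1} k1 : k = 1%N by lia.
  move: hnk; rewrite k1 divr1 mulr1 => hnk.
  have n2 : (2 <= n)%N by case: (n) n0 nk => [//|[|//]] _ /(_ erefl); rewrite k1.
  have ln1 := log2_ge1 R n2.
  apply: le_trans hnk.
  have c18 : 1 <= (2 : R) ^+ 18 by rewrite exprn_ege1 //; lra.
  have h : s%:R <= s%:R * log2 n%:R :> R by exact: ler_peMr.
  move: (2 ^+ 18) (log2 _) c18 h => c l c1 h.
  have -> : c * s%:R * (1 + 1)%:R * l = c * (2 * (s%:R * l)) by rewrite natrD; ring.
  by nra.
have lk1 := log2_ge1 R k2; apply: le_trans hnklog.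
have c15 : 1 <= (2 : R) ^+ 15 by rewrite exprn_ege1 //; lra.
move: (log2 _) (2 ^+ 15) lk1 c15 => l c l1 c1.
rewrite -!mulrA -[leLHS]mul1r; apply: ler_pM => //; first exact: mulr_ge0.
by rewrite ler_wpM2l // ler_peMr.
Qed.

(** The range [2 <= s] matters: a single set is a sunflower with one petal and itself as core, so
    for [s = 1] the hypothesis on [F] would hold vacuously while [phi 1 t = 0]. *)
Theorem theorem3 (R : realType) (s t n k : nat) (F : {set {set 'I_n}})
    (hs : (2 <= s)%N) (ht : (0 < t)%N) (hn : (0 < n)%N) (hk : (0 < k)%N)
    (htk : (t <= k)%N)
    (hnk : 2 ^+ 18 * s%:R * (t + 1)%:R * log2 (n%:R / k%:R)
             <= n%:R / k%:R :> R)
    (hnklog : 2 ^+ 15 * s%:R * k%:R * log2 k%:R <= n%:R :> R)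
    (hF : uniform k F)
    (hfree : forall S : {set {set 'I_n}}, S \subset F -> sunflower s S ->
               ~ (#|core S| <= t - 1)%N) :
  #|F|%:R <=
    (phi s t)%:R * 'C(n - t, k - t)%:R
    + (2 ^+ 14 * s%:R * log2 t%:R) ^+ t
      * ((2 ^+ 19 * s%:R * (t + 1)%:R * log2 (n%:R / k%:R)) / (n%:R / k%:R))
      * 'C(n - t, k - t)%:R :> R.
Proof.
have free : low_core_free s t F.
  by move=> S SF sunS; have := hfree S SF sunS; move/negP; rewrite -ltnNge; lia.
have [t2|t1] := leqP 2 t; first exact: low_core_free_bound.
have {ht t1} t1 : t = 1%N by lia.
(* [log2 1 = 0] removes the error term, which leaves the sharp bound to be proved. *)
subst t; rewrite [log2 1%:R]/log2 ln1 mul0r mulr0 expr1 !mul0r addr0 -natrM ler_nat.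
suff h : (#|F| <= s.-1 * 'C(n - 1, k - 1))%N.
  by apply: leq_trans h _; rewrite leq_mul2r phi1_ge ?orbT // ltnW.
case: n hn F hnk hnklog hF hfree free => // n _ F hnk hnklog hF _ free.
rewrite !subn1 /=.
(* Here the ground set has [n.+1] points; on a single point with [k = 1] there is at most one
   member, and [1 <= s.-1]. *)
have [/andP[/eqP n0 /eqP k1]|nk1] := boolP ((n == 0) && (k == 1))%N.
  subst n k; rewrite bin0 muln1; apply: (@leq_trans 1); last by lia.
  have /subset_leq_card : F \subset [set A : {set 'I_1} | #|A| == 1%N].
    by apply/subsetP => A /hF cA; rewrite inE cA.
  by rewrite card_draws card_ord.
apply: matching_free_bound => //; apply: ground_set_large hnk hnklog _ => //; first by lia.
by move=> [n0]; apply: contra nk1 => /eqP ->; rewrite n0.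
Qed.
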